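(* For every fixed integer $m\ge 2$, the following problem is solvable in polynomial time: given a Kunz-coordinates vector $x\in\mathbb{Z}_+^{m-1}$ (equivalently, a numerical semigroup of multiplicity $m$ given by its Kunz-coordinates vector), find a minimal decomposition of $x$ into $m$-irreducible Kunz-coordinates vectors.
   Context: $\mathbb{Z}_+$ denotes the non-negative integers. A numerical semigroup is a subset $S\subseteq\mathbb{Z}_+$ closed under addition, containing $0$, with $\mathbb{Z}_+\setminus S$ finite; its multiplicity is $\min(S\setminus\{0\})$. For $S$ of multiplicity $m$ and $1\le i\le m-1$, let $w_i$ be the least element of $S$ congruent to $i$ modulo $m$. The Kunz-coordinates vector of $S$ is $x\in\mathbb{Z}_+^{m-1}$ with $x_i=(w_i-i)/m$. A vector in $\mathbb{Z}_+^{m-1}$ is a Kunz-coordinates vector if it arises in this way from a (necessarily unique) numerical semigroup of multiplicity $m$. A numerical semigroup of multiplicity $m$ is $m$-irreducible if it is not the intersection of two numerical semigroups of multiplicity $m$ containing it properly; a Kunz-coordinates vector is $m$-irreducible if its semigroup is. A decomposition of $x$ into $m$-irreducible Kunz-coordinates vectors is a finite set $\{x^1,\ldots,x^r\}\subseteq\mathbb{Z}_+^{m-1}$ of $m$-irreducible Kunz-coordinates vectors whose associated semigroups intersect to the semigroup of $x$. It is minimal if $r$ is minimum among all such decompositions. Polynomial time means polynomial in the binary encoding length of $x$, with $m$ a constant. *)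

(* Defs.v *)
From Corelib Require Import BinNums.
From mathcomp Require Import all_boot.
From mathcomp Require Import classical_sets cardinality.

Set Implicit Arguments.
Unset Strict Implicit.
Unset Printing Implicit Defensive.

Local Open Scope classical_set_scope.

Record numerical_semigroup (S : set nat) : Prop := NumericalSemigroup {
  nsg_zero : S 0;
  nsg_add : forall a b, S a -> S b -> S (a + b);
  nsg_cofinite : finite_set (~` S)
}.

Definition is_least (A : set nat) (n : nat) : Prop :=
  A n /\ forall k, A k -> n <= k.

Definition has_multiplicity (S : set nat) (m : nat) : Prop :=
  is_least (S `\ 0) m.

Definition semigroup_of_mult (m : nat) (S : set nat) : Prop :=
  numerical_semigroup S /\ has_multiplicity S m.

(* A vector x in Z_+^(m-1) is a tuple whose entry of index j < m - 1 is the
   coordinate x_(j+1).  The least element w of S congruent to j + 1 mod m is at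
   least j + 1, so the subtraction is not truncated and the division is exact. *)
Definition kunz_vector_of (m : nat) (S : set nat) (x : m.-1.-tuple nat) : Prop :=
  semigroup_of_mult m S /\
  forall j : 'I_m.-1, exists w : nat,
    is_least [set s | S s /\ s = j.+1 %[mod m]] w /\
    tnth x j = (w - j.+1) %/ m.

Definition is_kunz_vector (m : nat) (x : m.-1.-tuple nat) : Prop :=
  exists S : set nat, kunz_vector_of S x.

Definition m_irreducible (m : nat) (S : set nat) : Prop :=
  semigroup_of_mult m S /\
  ~ exists S1 S2 : set nat,
      [/\ semigroup_of_mult m S1, semigroup_of_mult m S2,
          S `<` S1, S `<` S2 & S = S1 `&` S2].

Definition m_irreducible_vector (m : nat) (x : m.-1.-tuple nat) : Prop :=
  exists S : set nat, kunz_vector_of S x /\ m_irreducible m S.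

(* Finite sets of vectors are duplicate-free sequences.  [F y] is the semigroup
   with Kunz-coordinates vector y, for y in D. *)
Definition decomposition (m : nat) (x : m.-1.-tuple nat)
    (D : seq (m.-1.-tuple nat)) : Prop :=
  [/\ uniq D,
      forall y, y \in D -> m_irreducible_vector y
    & exists F : m.-1.-tuple nat -> set nat,
        (forall y, y \in D -> kunz_vector_of (F y) y) /\
        kunz_vector_of (\bigcap_(y in [set` D]) F y) x].

Definition minimal_decomposition (m : nat) (x : m.-1.-tuple nat)
    (D : seq (m.-1.-tuple nat)) : Prop :=
  decomposition x D /\
  forall D' : seq (m.-1.-tuple nat), decomposition x D' -> size D <= size D'.

Inductive symbol := Zero | One | Comma | Semicolon.

Inductive direction := Left | Stay | Right.

(* A tape cell; [None] is the blank. *)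
Definition cell := option symbol.

(* A two-way infinite tape: the cells to the left of the head, and the cells
   from the head rightwards (scanned cell included), both listed moving away
   from the head.  All cells beyond the two lists are blank. *)
Record tape := Tape { tape_left : seq cell; tape_right : seq cell }.

Definition tape_read (t : tape) : cell := head None (tape_right t).

Definition tape_write (a : cell) (t : tape) : tape :=
  Tape (tape_left t) (a :: behead (tape_right t)).

Definition tape_move (d : direction) (t : tape) : tape :=
  let: Tape l r := t in
  match d with
  | Left => Tape (behead l) (head None l :: r)
  | Stay => t
  | Right => Tape (head None r :: l) (behead r)
  end.

(* The number of tapes is [extra_tapes + 1]. *)
Record machine := Machine {
  extra_tapes : nat;
  state : finType;
  start : state;
  halting : pred state;
  transition : state -> {ffun 'I_extra_tapes.+1 -> cell} ->
               state * {ffun 'I_extra_tapes.+1 -> cell * direction}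
}.

Record config (M : machine) := Config {
  config_state : state M;
  config_tapes : {ffun 'I_(extra_tapes M).+1 -> tape}
}.

Definition step (M : machine) (c : config M) : config M :=
  let: Config q ts := c in
  if halting q then c else
  let: (q', act) := transition q [ffun i => tape_read (ts i)] in
  Config q' [ffun i => tape_move (act i).2 (tape_write (act i).1 (ts i))].

(* The input is on the first tape, with the head on its first symbol. *)
Definition initial (M : machine) (w : seq symbol) : config M :=
  Config (start M)
    [ffun i => if i == ord0 then Tape [::] (map Some w) else Tape [::] [::]].

Fixpoint word_of_cells (r : seq cell) : seq symbol :=
  if r is Some a :: r' then a :: word_of_cells r' else [::].

(* The output is read on the last tape, from the head up to the first blank. *)
Definition output (M : machine) (c : config M) : seq symbol :=
  word_of_cells (tape_right (config_tapes c ord_max)).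

Definition computes_within (M : machine) (w v : seq symbol) (t : nat) : Prop :=
  exists n : nat,
    let c := iter n (@step M) (initial M w) in
    [/\ n <= t, halting (config_state c) & output c = v].

(* [solution x y] says that y is a correct answer on the instance x; nothing is
   required of the machine on words that do not encode a valid instance. *)
Definition poly_time_solvable (I O : Type)
    (encI : I -> seq symbol) (encO : O -> seq symbol)
    (valid : I -> Prop) (solution : I -> O -> Prop) : Prop :=
  exists (M : machine) (c d : nat), forall x : I, valid x ->
    exists y : O, solution x y /\
      computes_within M (encI x) (encO y) (c * size (encI x) ^ d + c).

(* Least significant bit first; 0 is the empty word. *)
Fixpoint encode_positive (p : positive) : seq symbol :=
  match p with
  | xH => [:: One]
  | xO p' => Zero :: encode_positive p'
  | xI p' => One :: encode_positive p'
  end.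

Definition encode_nat (n : nat) : seq symbol :=
  if bin_of_nat n is Npos p then encode_positive p else [::].

Definition encode_vector (k : nat) (x : k.-tuple nat) : seq symbol :=
  flatten [seq rcons (encode_nat n) Comma | n <- x].

Definition encode_vectors (k : nat) (D : seq (k.-tuple nat)) : seq symbol :=
  flatten [seq rcons (encode_vector x) Semicolon | x <- D].

(* Main.v *)
Require Import Defs.
From HB Require Import structures.
From mathcomp Require Import all_boot.
From mathcomp Require Import ssralg ssrnum ssrint zify.
From mathcomp Require Import boolp classical_sets cardinality.

Set Implicit Arguments.
Unset Strict Implicit.
Unset Printing Implicit Defensive.

(** Let m = n + 1.  A vector v of n coordinates is a Kunz-coordinates vector
    exactly when its coordinates are positive and
    v_((i + j) mod m) <= v_i + v_j + (i + j) div m, with v_0 = 0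
    ([kunz_vector_ofP]); inclusion of semigroups reverses the pointwise order of
    vectors, and intersection is the pointwise maximum.  So a decomposition of x
    is a set of irreducible vectors below x that attain x in every coordinate
    ([decompositionP]).  For each coordinate some irreducible vector below x
    attains it ([irreducible_below]), hence n vectors, repetitions allowed, are
    enough to describe a minimal decomposition.  A vector is irreducible when at
    most one of its coordinates can be lowered by 1 within the Kunz-coordinates
    vectors ([irreducibleP]).

    All these conditions on x and on the n vectors are Boolean combinations of
    a fixed finite number of inequalities z_w + a <= z_u + z_v + b with
    a, b <= 2, whose unknowns are coordinates or 0.  An automaton that reads all
    unknowns in parallel, least significant bit first, decides every such
    inequality at once: its state is the list of carries, which stay bounded
    ([carries_invariant], [truthP]).  The number of distinct vectors among the n
    is then a function of the final state.

    It remains to find, for given x, digits of the unknown y that lead the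
    automaton to a state of least cost.  A Turing machine does this in linear
    time ([optimizer_computes]).  Going from the least to the most significant
    digit of x it computes the set of states reachable for some choice of the
    digits of y, and records each set on its tapes.  It then picks the best
    reachable state and walks back, choosing at each position a recorded
    predecessor and the digits of y that lead from it to the current state.
    All unknowns are bounded by the entries of x, so the digits of x delimit the
    search. *)

(** * Multi-tape programs on absolutely addressed tapes *)

Section NamedTapes.

Variable J : finType.

(** Programs address their tapes by name, cells by an absolute position in
    [int], and describe a tape by its content function; equations between
    configurations then need no care about trailing blanks. *)
Inductive tape_name := TIn | TOut | Work of J.

Definition name_of (i : 'I_#|J|.+2) : tape_name :=
  if i == 0 :> nat then TIn
  else if insub i.-1 is Some k then Work (enum_val (k : 'I_#|J|)) else TOut.

Definition index_of (w : tape_name) : 'I_#|J|.+2 :=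
  match w with
  | TIn => ord0
  | TOut => ord_max
  | Work j => inord (enum_rank j).+1
  end.

Lemma index_ofK w : name_of (index_of w) = w.
Proof.
case: w => [||j] //; rewrite /name_of /=; first by rewrite insubF ?ltnn.
have lt_j : (enum_rank j).+1 < #|J|.+2 by rewrite !ltnS; apply/ltnW.
by rewrite inordK //= valK enum_rankK.
Qed.

Lemma name_of_TIn i : name_of i = TIn -> i = ord0.
Proof.
rewrite /name_of; case: ifP => [/eqP i0 _|_]; first exact: val_inj.
by case: insub.
Qed.

Record program := Program {
  pstate : finType;
  pstart : pstate;
  phalt : pred pstate;
  pstep : pstate -> (tape_name -> cell) ->
          pstate * (tape_name -> cell * direction)
}.

Record iconfig (T : Type) := IConfig {
  istate : T;
  icell : tape_name -> int -> cell;
  ihead : tape_name -> int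
}.

Definition put (f : int -> cell) (h : int) (a : cell) : int -> cell :=
  fun z => if z == h then a else f z.

Definition shift (d : direction) (h : int) : int :=
  match d with Left => h - 1 | Stay => h | Right => h + 1 end%R.

Definition istep (p : program) (c : iconfig (pstate p)) : iconfig (pstate p) :=
  let: IConfig q f h := c in
  if phalt q then c else
  let: (q', act) := pstep q (fun w => f w (h w)) in
  IConfig q' (fun w => put (f w) (h w) (act w).1) (fun w => shift (act w).2 (h w)).

Definition machine_of (p : program) : machine :=
  @Machine #|J|.+1 (pstate p) (pstart p) (@phalt p)
    (fun q r =>
       let: (q', act) := pstep q (fun w => r (index_of w)) in
       (q', [ffun i => act (name_of i)])).

(** The list representation is read relative to the head, where every cell
    beyond the two lists is blank. *)
Definition holds (t : tape) (f : int -> cell) (h : int) : Prop :=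
  forall k : nat, nth None (tape_right t) k = f (h + k%:Z)%R /\
                  nth None (tape_left t) k = f (h - k.+1%:Z)%R.

Lemma holds_act t f h a d : holds t f h ->
  holds (tape_move d (tape_write a t)) (put f h a) (shift d h).
Proof.
case: t => l r th k; rewrite /put.
have L j : nth None (behead l) j = f (h - j.+2%:Z)%R.
  by rewrite nth_behead; case: (th j.+1).
have R j : nth None (behead r) j = f (h + j.+1%:Z)%R.
  by rewrite nth_behead; case: (th j.+1).
have L0 : head None l = f (h - 1)%R by rewrite -nth0; case: (th 0).
have Lk j : nth None l j = f (h - j.+1%:Z)%R by case: (th j).
case: d => /=.
- split; last first.
    by rewrite L; case: eqP => [|_]; [lia | congr f; lia].
  case: k => [|[|k]] /=.
  + by rewrite L0; case: eqP => [|_]; [lia | congr f; lia].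
  + by case: eqP => [//|]; lia.
  + by rewrite R; case: eqP => [|_]; [lia | congr f; lia].
- split; last by rewrite Lk; case: eqP => [|_ //]; lia.
  case: k => [|k] /=; first by case: eqP => [//|]; lia.
  by rewrite R; case: eqP => [|_ //]; lia.
- split; last first.
    case: k => [|k] /=; first by case: eqP => [//|]; lia.
    by rewrite Lk; case: eqP => [|_]; [lia | congr f; lia].
  by rewrite R; case: eqP => [|_]; [lia | congr f; lia].
Qed.

Definition simulates (p : program) (c : config (machine_of p))
    (d : iconfig (pstate p)) : Prop :=
  config_state c = istate d /\
  forall i, holds (config_tapes c i) (icell d (name_of i)) (ihead d (name_of i)).

Lemma simulates_step p (c : config (machine_of p)) d :
  simulates c d -> simulates (step c) (istep d).
Proof.
case: c d => [q ts] [_ f h] [/= <- hts].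
case hq: (phalt q) => //.
have -> : (fun w => [ffun i => tape_read (ts i)] (index_of w)) =
          (fun w => f w (h w)).
  apply/funext => w; rewrite ffunE /tape_read -nth0.
  by have [-> _] := hts (index_of w) 0; rewrite index_ofK GRing.addr0.
case: (pstep q _) => q' act; split=> //= i.
by rewrite !ffunE; apply: holds_act.
Qed.

Definition word_at (w : seq symbol) (z : int) : cell :=
  if z is Posz k then onth w k else None.

Definition istart (p : program) (w : seq symbol) : iconfig (pstate p) :=
  IConfig (pstart p)
    (fun i => if i is TIn then word_at w else fun=> None) (fun=> 0%R).

Lemma simulates_start p w : simulates (initial (machine_of p) w) (istart p w).
Proof.
split=> //= i k; rewrite ffunE.
case: eqP => [->|/eqP i0] /=.
  by rewrite nth_nil add0n onthE.
have : name_of i <> TIn by move/name_of_TIn/eqP; apply/negP.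
by case: (name_of i) => //; rewrite !nth_nil.
Qed.

Lemma word_of_cells_onth r u :
  (forall k, nth None r k = onth u k) -> word_of_cells r = u.
Proof.
elim: u r => [|s u IHu] [|[a|] r] ru //=; try by have := ru 0.
have [->] : Some a = Some s := ru 0.
by congr cons; apply: IHu => k; have := ru k.+1.
Qed.

(** The configuration reached by the program determines the one reached by the
    machine up to the representation of tapes, and the output only depends on
    the represented cells. *)
Lemma machine_of_computes p w v t n d :
  iter n (@istep p) (istart p w) = d -> n <= t -> phalt (istate d) ->
  icell d TOut = word_at v -> ihead d TOut = 0%R ->
  computes_within (machine_of p) w v t.
Proof.
move=> run n_t halted out pos; exists n => c.
have [cd tapes] : simulates c d.
  rewrite /c -run; elim: n {c n_t run} => [|n IHn] /=; first exact: simulates_start.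
  exact: simulates_step.
split; rewrite ?cd //.
apply: word_of_cells_onth => k.
have := tapes ord_max k; rewrite -[ord_max]/(index_of TOut) index_ofK out pos.
by rewrite GRing.add0r; case.
Qed.

End NamedTapes.

Arguments TIn {J}.
Arguments TOut {J}.
Arguments Work {J}.

(** * Binary digits *)

Definition bit_symbol (b : bool) : symbol := if b then One else Zero.

Definition not_comma (a : symbol) : bool := if a is Comma then false else true.

Definition upper_bits (j v : nat) : nat := iter j half v.

Definition digit (j v : nat) : bool := odd (upper_bits j v).

(** The encoding lists the digits from the least significant one, without
    leading zeros at its end; this recursion is what lets a word be built from
    its most significant digit backwards. *)
Lemma encode_natE v :
  encode_nat v = if v == 0 then [::] else bit_symbol (odd v) :: encode_nat v./2.
Proof.
rewrite /encode_nat -{2 3 4}[v]bin_of_natK.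
case: (bin_of_nat v) => [|[p|p|]] //=.
- by rewrite NatTrec.doubleE /= odd_double /= uphalf_double -/(nat_of_bin (BinNums.Npos p)) nat_of_binK.
- rewrite NatTrec.doubleE odd_double doubleK -/(nat_of_bin (BinNums.Npos p)) nat_of_binK.
  have p0 : nat_of_bin (BinNums.Npos p) != 0.
    by apply/eqP => p0; have := nat_of_binK (BinNums.Npos p); rewrite p0.
  by rewrite -double0 (inj_eq double_inj) (negPf p0).
Qed.

Lemma encode_nat_digits v :
  all not_comma (encode_nat v).
Proof.
elim/ltn_ind: v => v IHv; rewrite encode_natE.
case: eqP => //= v0; rewrite IHv ?andbT; first by case: odd.
by lia.
Qed.

Lemma size_encode_nat v j : (j < size (encode_nat v)) = (0 < upper_bits j v).
Proof.
elim: j v => [|j IHj] v; rewrite encode_natE.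
  by case: eqP => [->|/eqP]; rewrite ?lt0n //= => ->.
rewrite /upper_bits iterSr -/(upper_bits j v./2) -IHj.
by case: eqP => [->|//].
Qed.

Lemma onth_encode_nat v j :
  onth (encode_nat v) j =
  if 0 < upper_bits j v then Some (bit_symbol (digit j v)) else None.
Proof.
case: ifP => [|/negbT]; last first.
  by rewrite -size_encode_nat -leqNgt => /onth_default.
elim: j v => [|j IHj] v; rewrite encode_natE.
  by rewrite lt0n /= => /negPf->.
rewrite /digit /upper_bits !iterSr -/(upper_bits j v./2) => v_gt0.
case: eqP => [v0|_] /=; last by rewrite IHj.
by move: v_gt0; rewrite -size_encode_nat v0.
Qed.

Lemma upper_bitsE j v : upper_bits j v = v %/ 2 ^ j.
Proof.
elim: j => [|j IHj]; first by rewrite divn1.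
by rewrite /upper_bits iterS -/(upper_bits j v) IHj -divn2 -divnMA expnSr.
Qed.

Lemma upper_bits_eq0 j v : (upper_bits j v == 0) = (v < 2 ^ j).
Proof. by rewrite upper_bitsE -leqn0 leqNgt divn_gt0 ?expn_gt0 // -ltnNge. Qed.

Definition is_one (a : cell) : bool := if a is Some One then true else false.

(** * A machine that optimizes over the inputs of an automaton *)

Section Optimizer.

(** The automaton reads in parallel n given numbers and a family of unknown
    numbers indexed by [P].  [cost] ranks its final states and [format] says, for
    each final state, how the output word is composed of fixed symbols and of
    encodings of unknowns. *)
Variables (n : nat) (P Q : finType) (q0 : Q).
Variable delta : Q -> ('I_n -> bool) -> (P -> bool) -> Q.
Variables (cost : Q -> nat) (format : Q -> seq (symbol + P)).

Fixpoint dfa_run (x : 'I_n -> nat) (y : P -> nat) (j : nat) : Q :=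
  if j is j'.+1
  then delta (dfa_run x y j') (fun i => digit j' (x i)) (fun t => digit j' (y t))
  else q0.

Definition successors (R : {set Q}) (a : 'I_n -> bool) : {set Q} :=
  [set delta s.1 a s.2 | s : Q * {ffun P -> bool} & s.1 \in R].

(** In a run from an initial configuration the default is never used, because
    the current state then has a predecessor in the recorded set. *)
Definition choose_pred (R : {set Q}) (a : 'I_n -> bool) (q : Q) :
    Q * {ffun P -> bool} :=
  odflt (q, [ffun=> false])
    [pick s : Q * {ffun P -> bool} | (s.1 \in R) && (delta s.1 a s.2 == q)].

Lemma choose_predP R a q : q \in successors R a ->
  (choose_pred R a q).1 \in R /\
  delta (choose_pred R a q).1 a (choose_pred R a q).2 = q.
Proof.
case/imsetP=> s; rewrite inE => sR ->; rewrite /choose_pred.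
case: pickP => [s' /andP[? /eqP] //|/(_ s)].
by rewrite sR eqxx.
Qed.

Definition best (R : {set Q}) : Q :=
  odflt q0 [pick q in R | [forall s in R, cost q <= cost s]].

Lemma bestP (R : {set Q}) q : q \in R ->
  best R \in R /\ forall s, s \in R -> cost (best R) <= cost s.
Proof.
move=> qR; rewrite /best; case: pickP => [s /andP[sR /forall_inP] //|].
have [s sR min_s] := arg_minnP cost qR.
have {}sR : s \in R := sR.
by move=> /(_ s); rewrite /= sR /= => /negP[]; apply/forall_inP.
Qed.

Fixpoint reachable (x : 'I_n -> nat) (j : nat) : {set Q} :=
  if j is j'.+1 then successors (reachable x j') (fun i => digit j' (x i))
  else [set q0].

(** [reachable x j] does not depend on the unknowns, so it can be computed by
    a deterministic sweep over the digits of x. *)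
Lemma dfa_run_reachable x y j : dfa_run x y j \in reachable x j.
Proof.
elim: j => [|j IHj] /=; first by rewrite inE.
apply/imsetP; exists (dfa_run x y j, [ffun t => digit j (y t)]).
  by rewrite inE IHj.
by congr delta; apply/funext => t; rewrite ffunE.
Qed.

(** The work tapes: one for each given number, one for each state of the
    automaton (whose cell at position j says whether that state is reachable
    after j digits), and one for each unknown. *)
Let J : finType := ('I_n + Q + P)%type.
Notation TX i := (Work (inl (inl i) : J)).
Notation TH q := (Work (inl (inr q) : J)).
Notation TY t := (Work (inr t : J)).

Definition tapes (A : Type) (a_in a_out : A) (ax : 'I_n -> A) (ah : Q -> A)
    (ay : P -> A) (w : tape_name J) : A :=
  match w with
  | TIn => a_in
  | TOut => a_out
  | Work (inl (inl i)) => ax i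
  | Work (inl (inr q)) => ah q
  | Work (inr t) => ay t
  end.

Definition max_format : nat := \max_q size (format q).

(** The machine splits the input into its numbers ([Unpack]), brings the heads
    back ([RewindX]), records the reachable sets ([Forward]), determines the
    unknowns ([Backward]), writes the output ([Emit]) and brings the output head
    back ([RewindOut]).  [Backward] carries the chosen final state, the current
    state, and for each unknown whether a digit 1 has already been met: the
    sweep starts at the most significant digit, and the leading zeros must
    become blanks. *)
Inductive phase :=
  | Unpack of 'I_n.+1
  | RewindX
  | Forward of {set Q}
  | Backward of Q & Q & {ffun P -> bool}
  | Emit of Q & 'I_max_format.+1
  | RewindOut
  | Done.

Definition phase_code (s : phase) :
    'I_n.+1 + {set Q} + (Q * Q * {ffun P -> bool}) + (Q * 'I_max_format.+1) + 'I_3 :=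
  match s with
  | Unpack i => inl (inl (inl (inl i)))
  | RewindX => inr (inord 0)
  | Forward R => inl (inl (inl (inr R)))
  | Backward qf q seen => inl (inl (inr (qf, q, seen)))
  | Emit qf pc => inl (inr (qf, pc))
  | RewindOut => inr (inord 1)
  | Done => inr (inord 2)
  end.

Definition phase_decode
    (c : 'I_n.+1 + {set Q} + (Q * Q * {ffun P -> bool}) + (Q * 'I_max_format.+1) + 'I_3) :
    phase :=
  match c with
  | inl (inl (inl (inl i))) => Unpack i
  | inl (inl (inl (inr R))) => Forward R
  | inl (inl (inr (qf, q, seen))) => Backward qf q seen
  | inl (inr (qf, pc)) => Emit qf pc
  | inr k => if k == 0 :> nat then RewindX else if k == 1 :> nat then RewindOut else Done
  end.

Lemma phase_codeK : cancel phase_code phase_decode.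
Proof. by case=> //=; rewrite inordK. Qed.

HB.instance Definition _ := Finite.copy phase (can_type phase_codeK).

Definition is_done (s : phase) : bool := if s is Done then true else false.

Definition phase_step (s : phase) (r : tape_name J -> cell) :
    phase * (tape_name J -> cell * direction) :=
  let stay w := (r w, Stay) in
  let go (d : direction) w := (r w, d) in
  match s with
  | Unpack i =>
    match r TIn with
    | None => (RewindX, tapes (stay TIn) (stay TOut) (fun j => go Left (TX j))
                              (fun q => stay (TH q)) (fun t => stay (TY t)))
    | Some Comma => (Unpack (inord i.+1),
                     tapes (go Right TIn) (stay TOut) (fun j => stay (TX j))
                           (fun q => stay (TH q)) (fun t => stay (TY t)))
    | Some a => (Unpack i,
                 tapes (go Right TIn) (stay TOut)
                   (fun j : 'I_n => if j == i :> nat then (Some a, Right) else stay (TX j))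
                   (fun q => stay (TH q)) (fun t => stay (TY t)))
    end
  | RewindX =>
    if [forall i : 'I_n, ~~ r (TX i)]
    then (Forward [set q0],
          tapes (stay TIn) (stay TOut) (fun i => go Right (TX i))
                (fun q => stay (TH q)) (fun t => stay (TY t)))
    else (RewindX,
          tapes (stay TIn) (stay TOut)
                (fun i => if r (TX i) then go Left (TX i) else stay (TX i))
                (fun q => stay (TH q)) (fun t => stay (TY t)))
  | Forward R =>
    if [forall i : 'I_n, ~~ r (TX i)]
    then (Backward (best R) (best R) [ffun=> false],
          tapes (stay TIn) (stay TOut) (fun i => go Left (TX i))
                (fun q => go Left (TH q)) (fun t => go Left (TY t)))
    else (Forward (successors R (fun i => is_one (r (TX i)))),
          tapes (stay TIn) (stay TOut) (fun i => go Right (TX i))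
                (fun q => (Some (bit_symbol (q \in R)), Right))
                (fun t => go Right (TY t)))
  | Backward qf q seen =>
    if [forall i : 'I_n, ~~ r (TX i)]
    then (Emit qf ord0,
          tapes (stay TIn) (stay TOut) (fun i => stay (TX i))
                (fun q => stay (TH q)) (fun t => go Right (TY t)))
    else
      let s := choose_pred [set q | is_one (r (TH q))]
                 (fun i => is_one (r (TX i))) q in
      (Backward qf s.1 [ffun t => seen t || s.2 t],
       tapes (stay TIn) (stay TOut) (fun i => go Left (TX i))
             (fun q => go Left (TH q))
             (fun t => (if seen t || s.2 t then Some (bit_symbol (s.2 t)) else None,
                        Left)))
  | Emit qf pc =>
    match onth (format qf) pc with
    | None => (RewindOut,
               tapes (stay TIn) (go Left TOut) (fun i => stay (TX i))
                     (fun q => stay (TH q)) (fun t => stay (TY t)))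
    | Some (inl a) => (Emit qf (inord pc.+1),
                       tapes (stay TIn) (Some a, Right) (fun i => stay (TX i))
                             (fun q => stay (TH q)) (fun t => stay (TY t)))
    | Some (inr u) =>
      if r (TY u) is Some a
      then (Emit qf pc,
            tapes (stay TIn) (Some a, Right) (fun i => stay (TX i))
                  (fun q => stay (TH q))
                  (fun t => if t == u then go Right (TY t) else stay (TY t)))
      else (Emit qf (inord pc.+1),
            tapes (stay TIn) (stay TOut) (fun i => stay (TX i))
                  (fun q => stay (TH q)) (fun t => stay (TY t)))
    end
  | RewindOut =>
    if r TOut
    then (RewindOut,
          tapes (stay TIn) (go Left TOut) (fun i => stay (TX i))
                (fun q => stay (TH q)) (fun t => stay (TY t)))
    else (Done,
          tapes (stay TIn) (go Right TOut) (fun i => stay (TX i))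
                (fun q => stay (TH q)) (fun t => stay (TY t)))
  | Done => (Done, stay)
  end.

Definition optimizer : program J :=
  @Program J phase (Unpack ord0) is_done phase_step.

Definition conf (s : phase) f_in f_out fx fh fy h_in h_out hx hh hy :
    iconfig J phase :=
  IConfig s (tapes f_in f_out fx fh fy) (tapes h_in h_out hx hh hy).

Definition reaches (k : nat) (c c' : iconfig J phase) : Prop :=
  iter k (@istep J optimizer) c = c'.

Lemma reaches_trans k l c d e :
  reaches k c d -> reaches l d e -> reaches (k + l) c e.
Proof. by rewrite /reaches addnC iterD => ->. Qed.

Lemma reachesS k c d e : reaches k c d -> reaches 1 d e -> reaches k.+1 c e.
Proof. by move=> H1 H2; rewrite -addn1; exact: reaches_trans H1 H2. Qed.

Lemma put_id f h : put f h (f h) = f.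
Proof. by apply/funext => z; rewrite /put; case: eqP => [->|]. Qed.

Lemma put_rcons w a : put (word_at w) (size w) (Some a) = word_at (rcons w a).
Proof.
apply/funext => -[k|k] //=; rewrite /put -cats1 onth_cat eqz_nat.
by case: ltngtP => //= [lt|->]; [rewrite !onth_default ?subnK //= ; lia | rewrite subnn].
Qed.

(** The effect on one tape of one action, stated separately from the machine so
    that each tape of a step is checked on its own. *)
Definition moves (f : int -> cell) (h : int) (a : cell * direction)
    (f' : int -> cell) (h' : int) : Prop :=
  put f h a.1 = f' /\ shift a.2 h = h'.

Lemma moves_go f h a d h' : a = f h -> shift d h = h' -> moves f h (a, d) f h'.
Proof. by move=> ->; split=> //=; exact: put_id. Qed.

(** Closes the obligations of tapes whose content does not change and whose head
    position is immediate. *)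
Ltac unmoved := first [by apply: moves_go | by move=> ?; apply: moves_go].

Lemma moves_append w a (h : int) h' : h = size w -> h' = size (rcons w a) ->
  moves (word_at w) h (Some a, Right) (word_at (rcons w a)) h'.
Proof. by move=> -> ->; split; rewrite /= ?put_rcons // size_rcons; lia. Qed.

Lemma step_conf s s' a_in a_out ax ah ay f_in f_out fx fh fy h_in h_out hx hh hy
    f_in' f_out' fx' fh' fy' h_in' h_out' hx' hh' hy' :
  is_done s = false ->
  phase_step s (tapes (f_in h_in) (f_out h_out) (fun i => fx i (hx i))
                  (fun q => fh q (hh q)) (fun t => fy t (hy t))) =
    (s', tapes a_in a_out ax ah ay) ->
  moves f_in h_in a_in f_in' h_in' -> moves f_out h_out a_out f_out' h_out' ->
  (forall i, moves (fx i) (hx i) (ax i) (fx' i) (hx' i)) ->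
  (forall q, moves (fh q) (hh q) (ah q) (fh' q) (hh' q)) ->
  (forall t, moves (fy t) (hy t) (ay t) (fy' t) (hy' t)) ->
  reaches 1 (conf s f_in f_out fx fh fy h_in h_out hx hh hy)
    (conf s' f_in' f_out' fx' fh' fy' h_in' h_out' hx' hh' hy').
Proof.
move=> not_done E [in1 in2] [out1 out2] X H Y; rewrite /reaches /conf /istep /= not_done.
set r := fun w => _.
have -> : r = tapes (f_in h_in) (f_out h_out) (fun i => fx i (hx i))
                (fun q => fh q (hh q)) (fun t => fy t (hy t)).
  by apply/funext; do 3?case.
rewrite E; congr IConfig; apply/funext => -[||[[i|q]|t]] //=;
  by [case: (X i) | case: (H q) | case: (Y t)].
Qed.

Variable x : 'I_n -> nat.

Definition xword (i : 'I_n) : int -> cell := word_at (encode_nat (x i)).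

Definition blank_tape : int -> cell := fun=> None.

Definition input : seq symbol :=
  flatten [seq rcons (encode_nat (x i)) Comma | i <- enum 'I_n].

(** * Splitting the input into its numbers *)

(** Reading the input at position k, in its number of index i, when the words
    [u] have been copied. *)
Definition unpacking (i : 'I_n.+1) (k : nat) (u : 'I_n -> seq symbol) :=
  conf (Unpack i) (word_at input) blank_tape (fun j => word_at (u j))
    (fun=> blank_tape) (fun=> blank_tape)
    k 0%R (fun j => size (u j) : int) (fun=> 0%R) (fun=> 0%R).

Lemma unpack_digits (i : 'I_n.+1) (pre w post : seq symbol) u :
  all not_comma w ->
  input = pre ++ w ++ post ->
  reaches (size w) (unpacking i (size pre) u)
    (unpacking i (size (pre ++ w)) (fun j : 'I_n => if j == i :> nat then u j ++ w else u j)).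
Proof.
elim: w pre u => [|a w IHw] pre u /=.
  rewrite cats0 => _ _; rewrite /reaches /=; congr unpacking.
  by apply/funext => j; rewrite cats0 if_same.
move=> /andP[a_digit w_digits] input_eq; rewrite -add1n.
set u1 := fun j : 'I_n => if j == i :> nat then rcons (u j) a else u j.
suff step1 : reaches 1 (unpacking i (size pre) u) (unpacking i (size (rcons pre a)) u1).
  apply: reaches_trans step1 _.
  have -> : (fun j : 'I_n => if j == i :> nat then u j ++ a :: w else u j) =
            (fun j : 'I_n => if j == i :> nat then u1 j ++ w else u1 j).
    by apply/funext => j; rewrite /u1; case: ifP; rewrite ?cat_rcons.
  by rewrite -cat_rcons; apply: IHw; rewrite ?cat_rcons.
apply: step_conf; first by [].
{ rewrite /= input_eq onth_cat ltnn subnn /=.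
  by case: a a_digit input_eq @u1. }
all: try unmoved.
- apply: moves_go; last by rewrite size_rcons /=; lia.
  by rewrite /= input_eq onth_cat ltnn subnn.
- by move=> j; rewrite /u1; case: ifP => _; [apply: moves_append | apply: moves_go].
Qed.

Lemma unpack_comma (i : 'I_n.+1) (pre post : seq symbol) u :
  i < n -> input = pre ++ Comma :: post ->
  reaches 1 (unpacking i (size pre) u) (unpacking (inord i.+1) (size (rcons pre Comma)) u).
Proof.
move=> lt_in input_eq; apply: step_conf; first by [].
{ by rewrite /= input_eq onth_cat ltnn subnn /=. }
all: try unmoved.
- apply: moves_go; last by rewrite size_rcons /=; lia.
  by rewrite /= input_eq onth_cat ltnn subnn.
Qed.

Definition prefix_words (i : nat) : seq symbol :=
  flatten [seq rcons (encode_nat (x j)) Comma | j <- take i (enum 'I_n)].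

Lemma unpack_prefix i : i <= n ->
  reaches (size (prefix_words i)) (unpacking ord0 0 (fun=> [::]))
    (unpacking (inord i) (size (prefix_words i))
       (fun j : 'I_n => if j < i then encode_nat (x j) else [::])).
Proof.
elim: i => [_|i IHi lt_in].
  rewrite /prefix_words take0 /reaches /=; congr unpacking; apply: val_inj.
  by rewrite /= inordK.
pose o := Ordinal lt_in.
have pre_eq : prefix_words i.+1 = rcons (prefix_words i ++ encode_nat (x o)) Comma.
  rewrite /prefix_words (take_nth o) ?size_enum_ord // map_rcons flatten_rcons.
  by rewrite (nth_ord_enum o o : nth o (enum 'I_n) i = o) rcons_cat.
have input_eq : exists post, input = prefix_words i.+1 ++ post.
  exists (flatten [seq rcons (encode_nat (x j)) Comma | j <- drop i.+1 (enum 'I_n)]).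
  by rewrite -flatten_cat -map_cat cat_take_drop.
case: input_eq => post input_eq.
have val_i : (inord i : 'I_n.+1) = i :> nat by rewrite inordK // ltnW.
rewrite {1}pre_eq size_rcons -addn1 size_cat.
apply: reaches_trans; first apply: reaches_trans (IHi (ltnW lt_in)) _.
  apply: unpack_digits (encode_nat_digits (x o)) _.
  by rewrite input_eq pre_eq cat_rcons -catA.
rewrite pre_eq.
set u := fun j => _.
have := @unpack_comma (inord i) (prefix_words i ++ encode_nat (x o)) post u.
rewrite val_i -cat_rcons -pre_eq => /(_ lt_in input_eq).
have -> // : u = (fun j : 'I_n => if j < i.+1 then encode_nat (x j) else [::]).
apply/funext => j; rewrite /u /= val_i ltnS.
case: ltngtP => // ji; congr (encode_nat (x _)); exact: val_inj.
Qed.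

Definition rewinding (s : phase) (h : 'I_n -> int) :=
  conf s (word_at input) blank_tape xword (fun=> blank_tape) (fun=> blank_tape)
    (size input) 0%R h (fun=> 0%R) (fun=> 0%R).

Lemma unpack_all :
  reaches (size input).+1 (unpacking ord0 0 (fun=> [::]))
    (rewinding RewindX (fun i => (size (encode_nat (x i)))%:Z - 1)%R).
Proof.
have := unpack_prefix (leqnn n).
rewrite /prefix_words take_oversize ?size_enum_ord // -/input => H.
apply: reachesS H _.
have -> : (fun j : 'I_n => if j < n then encode_nat (x j) else [::]) =
          fun j => encode_nat (x j).
  by apply/funext => j; rewrite ltn_ord.
apply: step_conf; first by [].
{ by rewrite /= onth_default. }
all: try unmoved.
- by apply: moves_go; rewrite /= ?onth_default.
Qed.

(** The length of the longest given number, which is where all sweeps turn. *)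
Definition max_size : nat := \max_(i < n) size (encode_nat (x i)).

Lemma word_at_some w z : (word_at w z : bool) = (0 <= z < (size w)%:Z)%R.
Proof. by case: z => k //=; rewrite onthTE. Qed.

(** The machine recognizes the end of a sweep by the fact that all tapes of
    given numbers are blank under their heads. *)
Lemma blank_columnP (h : 'I_n -> int) j :
  (forall i, (j < size (encode_nat (x i))) = (0 <= h i < (size (encode_nat (x i)))%:Z)%R) ->
  [forall i : 'I_n, ~~ (xword i (h i) : bool)] = (max_size <= j).
Proof.
move=> hP; apply/forallP/bigmax_leqP => [H i _ | H i].
  by have := H i; rewrite word_at_some -hP -leqNgt.
by rewrite word_at_some -hP -leqNgt H.
Qed.

(** The heads rewind independently and wait on the blank cell to the left of
    their word, at position -1. *)
Definition rewind_head (k : nat) (i : 'I_n) : int :=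
  if k < size (encode_nat (x i)) then ((size (encode_nat (x i)))%:Z - k.+1%:Z)%R
  else (-1)%R.

Lemma rewind_x :
  reaches max_size.+1 (rewinding RewindX (rewind_head 0))
    (rewinding (Forward [set q0]) (fun=> 0%R)).
Proof.
have blank k : [forall i : 'I_n, ~~ (xword i (rewind_head k i) : bool)] = (max_size <= k).
  by apply: blank_columnP => i; rewrite /rewind_head; case: ifP; lia.
have loop k : k <= max_size ->
    reaches k (rewinding RewindX (rewind_head 0)) (rewinding RewindX (rewind_head k)).
  elim: k => [//|k IHk] lt_k; apply: reachesS (IHk (ltnW lt_k)) _.
  apply: step_conf; first by [].
  { by rewrite /= blank leqNgt lt_k. }
  all: try unmoved.
  - move=> i /=; rewrite word_at_some /rewind_head.
    have [lt_k1|ge_k1] := ltnP k.+1 (size (encode_nat (x i))).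
      rewrite (ltnW lt_k1) ifT; last by lia.
      by apply: moves_go => //=; lia.
    have [lt_k'|ge_k] := ltnP k (size (encode_nat (x i))).
      rewrite ifT; last by lia.
      by apply: moves_go => //=; lia.
    by apply: moves_go.
apply: reachesS (loop _ (leqnn _)) _.
apply: step_conf; first by [].
{ by rewrite /= blank leqnn. }
all: try unmoved.
- move=> i; apply: moves_go => //; rewrite /rewind_head ifF //.
  by rewrite ltnNge leq_bigmax.
Qed.

(** * The two sweeps of the automaton *)

Definition history (j : nat) (q : Q) (z : int) : cell :=
  if z is Posz k then
    if k < j then Some (bit_symbol (q \in reachable x k)) else None
  else None.

Lemma xword_digit (i : 'I_n) (j : nat) :
  is_one (xword i j) = digit j (x i).
Proof.
rewrite /xword /= onth_encode_nat; case: ifP => [_|/negbT].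
  by case: (digit _ _).
by rewrite lt0n negbK /digit => /eqP->.
Qed.

Lemma history_reachable j k q : k < j ->
  is_one (history j q k) = (q \in reachable x k).
Proof. by rewrite /history => ->; case: (_ \in _). Qed.

Lemma blank_at (j : nat) : [forall i : 'I_n, ~~ (xword i j : bool)] = (max_size <= j).
Proof. exact: blank_columnP. Qed.

Lemma blank_before : [forall i : 'I_n, ~~ (xword i (-1)%R : bool)].
Proof. by apply/forallP. Qed.

Definition forwarding (j : nat) :=
  conf (Forward (reachable x j)) (word_at input) blank_tape xword (history j)
    (fun=> blank_tape) (size input) 0%R (fun=> j : int) (fun=> j : int) (fun=> j : int).

Lemma forward_all : reaches max_size (forwarding 0) (forwarding max_size).
Proof.
suff loop k : k <= max_size -> reaches k (forwarding 0) (forwarding k) by exact: loop.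
elim: k => [//|k IHk] lt_k; apply: reachesS (IHk (ltnW lt_k)) _.
apply: step_conf; first by [].
{ rewrite /phase_step /tapes blank_at leqNgt lt_k /=; congr (Forward (successors _ _), _).
  by apply/funext => i; rewrite -xword_digit. }
all: try unmoved.
- by move=> i; apply: moves_go => //=; lia.
- move=> q; split; last by rewrite /=; lia.
  apply/funext => -[z|z] //=; rewrite /put /history eqz_nat ltnS.
  by case: ltngtP => // ->.
- by move=> t; apply: moves_go => //=; lia.
Qed.

(** Having determined the digits of the unknowns from position j upwards, which
    form the numbers [v], the machine has written the encodings of [v] from
    position j on, and its heads are about to treat position j - 1. *)
Definition backing (qf q : Q) (v : P -> nat) (j : nat) :=
  conf (Backward qf q [ffun t => 0 < v t]) (word_at input) blank_tape xword
    (history max_size) (fun t z => word_at (encode_nat (v t)) (z - j%:Z)%R)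
    (size input) 0%R (fun=> (j%:Z - 1)%R) (fun=> (j%:Z - 1)%R) (fun=> (j%:Z - 1)%R).

(** Writing a blank instead of a zero above the leading digit keeps the word an
    encoding. *)
Lemma put_low_digit (j v : nat) (b : bool) :
  put (fun z => word_at (encode_nat v) (z - j.+1%:Z)%R) j
    (if (0 < v) || b then Some (bit_symbol b) else None) =
  (fun z => word_at (encode_nat (b + v.*2)) (z - j%:Z)%R).
Proof.
have E : encode_nat (b + v.*2) =
    if (0 < v) || b then bit_symbol b :: encode_nat v else [::].
  rewrite encode_natE half_bit_double oddD odd_double addbF oddb.
  by case: b v => -[|v].
apply/funext => z; rewrite /put E.
have [->|/eqP z_j] := eqVneq z j.
  by rewrite GRing.subrr /=; case: ifP.
case Ez : (z - j%:Z)%R => [[|k]|k]; first by lia.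
  have -> : (z - j.+1%:Z)%R = Posz k by lia.
  by case: ifP => //= H; case: v H {E} => [|v] //= _; rewrite [encode_nat 0]encode_natE onth0n.
have -> : (z - j.+1%:Z)%R = Negz k.+1 by lia.
by [].
Qed.

(** The numbers [y] are only known at the end of the sweep: each step back
    prepends a digit to [v], and the induction hypothesis for the longer numbers
    yields the final ones. *)
Lemma backward_all qf q v j : j <= max_size -> q \in reachable x j ->
  exists y, [/\ forall t, upper_bits j (y t) = v t, dfa_run x y j = q &
    exists q', reaches j (backing qf q v j) (backing qf q' y 0)].
Proof.
elim: j q v => [|j IHj] q v lt_j.
  rewrite inE => /eqP ->; exists v; split=> //; exists q0; exact: erefl.
move=> q_reach; have [] := choose_predP q_reach.
set s := choose_pred _ _ _ => s1 s2.
have [y [y_v y_run [q' back]]] := IHj s.1 (fun t => s.2 t + (v t).*2) (ltnW lt_j) s1.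
exists y; split.
- by move=> t; rewrite /upper_bits iterS -/(upper_bits j (y t)) y_v half_bit_double.
- rewrite /= y_run -[RHS]s2; congr delta; apply/funext => t.
  by rewrite /digit y_v oddD odd_double addbF oddb.
exists q'; rewrite -[j.+1]add1n; apply: reaches_trans back.
have head_j : (j.+1%:Z - 1)%R = j by lia.
rewrite /backing head_j; apply: step_conf; first by [].
{ rewrite /phase_step /tapes blank_at leqNgt lt_j /=.
  have -> : [set q1 | is_one (history max_size q1 j)] = reachable x j.
    by apply/setP => q1; rewrite inE history_reachable.
  have -> : (fun i => is_one (onth (encode_nat (x i)) j)) = (fun i => digit j (x i)).
    by apply/funext => i; rewrite -xword_digit.
  rewrite -/s; congr (Backward _ _ _, _).
  by apply/ffunP => t; rewrite !ffunE; case: (s.2 t) (v t) => -[]. }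
all: try unmoved.
- by move=> t; split=> //=; rewrite ffunE put_low_digit.
Qed.

Lemma forward_to_backward :
  reaches 1 (forwarding max_size)
    (backing (best (reachable x max_size)) (best (reachable x max_size)) (fun=> 0) max_size).
Proof.
apply: step_conf; first by [].
{ rewrite /phase_step /tapes blank_at leqnn /=; congr (Backward _ _ _, _). }
all: try unmoved.
- move=> t; have -> : (fun z => word_at (encode_nat 0) (z - max_size%:Z)%R) = blank_tape.
    by apply/funext => z; rewrite encode_natE; case: (_ - _)%R => // k; rewrite /= onth0n.
  by apply: moves_go.
Qed.

(** * Writing the output *)

Section Emission.

Variables (qf : Q) (y : P -> nat).

(** The first [pc] items of the format have produced the output word [u]. *)
Definition emitting (pc : nat) (u : seq symbol) (hy : P -> int) :=
  conf (Emit qf (inord pc)) (word_at input) (word_at u) xword (history max_size)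
    (fun t => word_at (encode_nat (y t))) (size input) (size u)
    (fun=> (-1)%R) (fun=> (-1)%R) hy.

(** The unknowns that a format copies.  Copying leaves the head at the end of
    the word, so each unknown may occur only once. *)
Definition copied (l : seq (symbol + P)) : seq P :=
  pmap (fun a => if a is inr t then Some t else None) l.

Definition item_word (a : symbol + P) : seq symbol :=
  match a with inl a => [:: a] | inr t => encode_nat (y t) end.

Lemma inord_pc pc : pc <= size (format qf) -> (inord pc : 'I_max_format.+1) = pc :> nat.
Proof.
by move=> le_pc; rewrite inordK // ltnS; apply: leq_trans le_pc _; apply: leq_bigmax.
Qed.

Lemma backward_to_emit q : reaches 1 (backing qf q y 0) (emitting 0 [::] (fun=> 0%R)).
Proof.
apply: step_conf; first by [].
{ rewrite /phase_step /tapes blank_before /=; congr (Emit _ _, _).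
  by apply: val_inj; rewrite /= inord_pc. }
all: try unmoved.
- by split=> //; rewrite put_id; apply/funext => -[] // k; rewrite /= onth0n.
- move=> t; have -> : (fun z => word_at (encode_nat (y t)) (z - 0%:Z)%R) =
                      word_at (encode_nat (y t)).
    by apply/funext => z; rewrite GRing.subr0.
  by apply: moves_go.
Qed.

Lemma emit_copy pc u hy t k :
  pc < size (format qf) -> onth (format qf) pc = Some (inr t) -> hy t = 0%R ->
  k <= size (encode_nat (y t)) ->
  reaches k (emitting pc u hy)
    (emitting pc (u ++ take k (encode_nat (y t))) (fun t' => if t' == t then k : int else hy t')).
Proof.
move=> lt_pc pc_t hy_t; elim: k => [_|k IHk lt_k].
  rewrite take0 cats0 /reaches /=; congr emitting; apply/funext => t'.
  by case: eqP => // ->.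
apply: reachesS (IHk (ltnW lt_k)) _.
have [a a_k] : exists a, onth (encode_nat (y t)) k = Some a.
  by case E: (onth _ _) => [a|]; [exists a | have := onthTE (encode_nat (y t)) k; rewrite E lt_k].
have -> : take k.+1 (encode_nat (y t)) = rcons (take k (encode_nat (y t))) a.
  by rewrite (take_nth a) // (onth_nth _ _ _ _ a_k).
rewrite -rcons_cat; apply: step_conf; first by [].
{ by rewrite /phase_step /tapes inord_pc ?(ltnW lt_pc) // pc_t eqxx /= a_k. }
all: try unmoved.
- exact: moves_append.
- move=> t' /=; case: eqP => [->|_]; last by apply: moves_go.
  by apply: moves_go => //=; lia.
Qed.

Lemma emit_all : uniq (copied (format qf)) ->
  (forall t, size (encode_nat (y t)) <= max_size) ->
  exists k hy', k <= size (format qf) * max_size.+1 /\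
    reaches k (emitting 0 [::] (fun=> 0%R))
      (emitting (size (format qf)) (flatten [seq item_word a | a <- format qf]) hy').
Proof.
move=> uniq_fmt small.
suff H l pc u hy : drop pc (format qf) = l -> pc <= size (format qf) ->
    uniq (copied l) -> (forall t, t \in copied l -> hy t = 0%R) ->
    exists k hy', k <= size l * max_size.+1 /\
      reaches k (emitting pc u hy)
        (emitting (size (format qf)) (u ++ flatten [seq item_word a | a <- l]) hy').
  by apply: (H (format qf) 0); rewrite ?drop0.
elim: l pc u hy => [|a l IHl] pc u hy fmt_pc le_pc.
  move=> _ _; exists 0, hy; split=> //; rewrite cats0 /reaches /=; congr emitting.
  by apply/eqP; rewrite eqn_leq le_pc -subn_eq0 -size_drop fmt_pc.
have lt_pc : pc < size (format qf) by rewrite -subn_gt0 -size_drop fmt_pc.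
have pc_a : onth (format qf) pc = Some a.
  by have := nth_drop pc None (map Some (format qf)) 0; rewrite -map_drop fmt_pc addn0 onthE.
have fmt_pc1 : drop pc.+1 (format qf) = l by rewrite -add1n -drop_drop fmt_pc /= drop0.
have in_pc := inord_pc le_pc.
case: a {fmt_pc} pc_a => [a|t] pc_a /=.
  move=> uniq_l zero_l.
  have [k [hy' [le_k reach_k]]] := IHl pc.+1 (rcons u a) hy fmt_pc1 lt_pc uniq_l zero_l.
  exists k.+1, hy'; split; first by rewrite mulSn; lia.
  rewrite -cat_rcons -add1n; apply: reaches_trans reach_k.
  apply: step_conf; first by [].
  { by rewrite /phase_step in_pc pc_a. }
  all: try unmoved.
  - exact: moves_append.
move=> /andP[t_l uniq_l] zero_l.
have hy_t : hy t = 0%R by apply: zero_l; rewrite mem_head.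
have := emit_copy u lt_pc pc_a hy_t (leqnn _); rewrite take_size.
set hy1 := fun t' => _; set u1 := u ++ _ => copy_t.
have [|k [hy' [le_k reach_k]]] := IHl pc.+1 u1 hy1 fmt_pc1 lt_pc uniq_l.
  move=> t' t'_l; rewrite /hy1; case: eqP => [t't|_]; first by rewrite t't in t'_l; rewrite t'_l in t_l.
  by apply: zero_l; rewrite inE t'_l orbT.
exists ((size (encode_nat (y t))).+1 + k), hy'; split.
  by rewrite mulSn leq_add // ltnS.
rewrite catA; apply: reaches_trans reach_k; apply: reachesS copy_t _.
apply: step_conf; first by [].
{ by rewrite /phase_step /tapes in_pc pc_a /hy1 eqxx /= onth_default. }
all: try unmoved.
Qed.

Definition rewinding_out (u : seq symbol) (h : int) (hy : P -> int) (s : phase) :=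
  conf s (word_at input) (word_at u) xword (history max_size)
    (fun t => word_at (encode_nat (y t))) (size input) h
    (fun=> (-1)%R) (fun=> (-1)%R) hy.

Lemma rewind_out u hy :
  reaches (size u).+2 (emitting (size (format qf)) u hy) (rewinding_out u 0%R hy Done).
Proof.
have start : reaches 1 (emitting (size (format qf)) u hy)
    (rewinding_out u ((size u)%:Z - 1)%R hy RewindOut).
  apply: step_conf; first by [].
  { by rewrite /phase_step inord_pc // onth_default. }
  all: try unmoved.
have loop k : k <= size u -> reaches k (rewinding_out u (k%:Z - 1)%R hy RewindOut)
    (rewinding_out u (-1)%R hy RewindOut).
  elim: k => [_|k IHk lt_k]; first exact: erefl.
  rewrite -add1n; apply: reaches_trans (IHk (ltnW lt_k)).
  apply: step_conf; first by [].
  { rewrite /phase_step /tapes word_at_some ifT //; lia. }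
  all: try unmoved.
  - by apply: moves_go => //=; lia.
rewrite -[_.+2]add1n; apply: reaches_trans start _; apply: reachesS (loop _ (leqnn _)) _.
apply: step_conf; first by [].
{ by []. }
all: try unmoved.
Qed.

Lemma size_items (l : seq (symbol + P)) :
  (forall t, size (encode_nat (y t)) <= max_size) ->
  size (flatten [seq item_word a | a <- l]) <= size l * max_size.+1.
Proof.
move=> small; elim: l => //= a l IHl; rewrite size_cat mulSn leq_add //.
by case: a => [a|t] //=; rewrite leqW.
Qed.

End Emission.

Lemma max_size_input : max_size <= size input.
Proof.
apply/bigmax_leqP => i _; rewrite /input size_flatten /shape -map_comp.
rewrite sumnE big_map big_enum /= (bigD1 i) //= size_rcons; lia.
Qed.

(** The first four sweeps have at most the length of the input.  The last two
    take about [max_size + 1] steps for each item of the output format, and the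
    number of items is bounded by a constant. *)
Theorem optimizer_computes : (forall q, uniq (copied (format q))) ->
  exists y : P -> nat, let q := dfa_run x y max_size in
    [/\ forall t, y t < 2 ^ max_size,
        forall y', cost q <= cost (dfa_run x y' max_size) &
        computes_within (machine_of optimizer) input
          (flatten [seq item_word y a | a <- format q])
          ((2 * max_format + 8) * size input + (2 * max_format + 8))].
Proof.
move=> uniq_fmt; set qf := best (reachable x max_size).
have [qf_reach qf_min] : qf \in reachable x max_size /\
    forall s, s \in reachable x max_size -> cost qf <= cost s.
  exact: bestP (dfa_run_reachable x (fun=> 0) max_size).
have [y [y_upper y_run [q' backward]]] := backward_all qf (fun=> 0) (leqnn _) qf_reach.
have y_lt t : y t < 2 ^ max_size by rewrite -upper_bits_eq0 y_upper.
have small t : size (encode_nat (y t)) <= max_size.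
  by rewrite leqNgt size_encode_nat y_upper.
exists y => q; rewrite {}/q y_run; split=> // [y'|].
  exact/qf_min/dfa_run_reachable.
have [k [hy [le_k emit]]] := emit_all (uniq_fmt qf) small.
have le_out := size_items (format qf) small.
set out := flatten _ in emit le_out *.
have rewind : reaches max_size.+1
    (rewinding RewindX (fun i => (size (encode_nat (x i)))%:Z - 1)%R) (forwarding 0).
  have -> : (fun i => (size (encode_nat (x i)))%:Z - 1)%R = rewind_head 0.
    by apply/funext => i; rewrite /rewind_head; case: ifP => //; case: size.
  have := rewind_x; rewrite /forwarding.
  have -> // : history 0 = fun=> blank_tape by apply/funext => ?; apply/funext; case.
have start : istart optimizer input = unpacking ord0 0 (fun=> [::]).
  have nil_blank : word_at [::] = blank_tape.
    by apply/funext; case=> // z; rewrite /= onth0n.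
  rewrite /unpacking nil_blank.
  by congr IConfig; apply/funext; do 3?case.
have run := reaches_trans (reaches_trans (reaches_trans (reaches_trans (reaches_trans
  (reaches_trans (reaches_trans unpack_all rewind) forward_all)
  forward_to_backward) backward) (backward_to_emit qf y q')) emit) (rewind_out qf y out hy).
rewrite /reaches -start in run.
apply: machine_of_computes run _ _ _ _ => //.
have := max_size_input; have : size (format qf) <= max_format by apply: leq_bigmax.
move: le_k le_out; move: (size (format qf)) (size out) max_format max_size (size input) => f o F L N.
move=> le_k le_o le_f le_L.
have le1 : f * L.+1 <= F * N.+1 by apply: leq_mul.
rewrite mulnDl -mulnA; move: le1; rewrite mulnS; lia.
Qed.

End Optimizer.

(** * Kunz-coordinates vectors and linear inequalities *)

Section KunzVectors.

Variable n : nat.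
Let m := n.+1.

(** Coordinates are numbered from 1, and coordinate 0 is 0: it belongs to the
    residue class of m itself. *)
Definition coord (x : seq nat) (i : nat) : nat := nth 0 (0 :: x) i.

Lemma coord_tnth (x : n.-tuple nat) (i : 'I_n) : coord x i.+1 = tnth x i.
Proof. by rewrite (tnth_nth 0). Qed.

(** An element s lies in the semigroup exactly when it is at least the Apery
    element v_i * m + i of its residue i, that is, when v_i <= s div m. *)
Definition semigroup_of (v : nat -> nat) : set nat :=
  [set s | v (s %% m) <= s %/ m]%classic.

Definition kunzb (v : nat -> nat) : bool :=
  [forall i : 'I_n, 0 < v i.+1] &&
  [forall i : 'I_n, forall j : 'I_n,
     v ((i.+1 + j.+1) %% m) <= v i.+1 + v j.+1 + (i.+1 + j.+1) %/ m].

Lemma mem_semigroup_of v q i : i < m -> semigroup_of v (q * m + i) <-> v i <= q.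
Proof.
by move=> lt_im; rewrite /semigroup_of /= modnMDl modn_small // divnMDl // divn_small // addn0.
Qed.

Lemma kunzb_gt0 v i : kunzb v -> 0 < i < m -> 0 < v i.
Proof. by case: i => // i /andP[/forallP v_gt0 _] lt_i; exact: (v_gt0 (@Ordinal n i lt_i)). Qed.

Lemma kunzb_add v i j : v 0 = 0 -> kunzb v -> i < m -> j < m ->
  v ((i + j) %% m) <= v i + v j + (i + j) %/ m.
Proof.
move=> v0 /andP[_ /forallP v_add].
case: i => [|i] lt_i; first by rewrite add0n v0 => lt_j; rewrite modn_small // leq_addr.
case: j => [|j] lt_j; first by rewrite addn0 v0 modn_small // addn0 leq_addr.
by have /forallP := v_add (@Ordinal n i lt_i) => /(_ (@Ordinal n j lt_j)).
Qed.

Lemma semigroup_of_add v a b : v 0 = 0 -> kunzb v ->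
  semigroup_of v a -> semigroup_of v b -> semigroup_of v (a + b).
Proof.
move=> v0 kv; rewrite /semigroup_of /= => va vb.
rewrite (divn_eq a m) (divn_eq b m) addnACA -mulnDl modnMDl divnMDl //.
apply: leq_trans (kunzb_add v0 kv _ _) _; rewrite ?ltn_mod //.
by rewrite leq_add2r leq_add.
Qed.

Lemma semigroup_of_kunz v : v 0 = 0 -> kunzb v -> semigroup_of_mult m (semigroup_of v).
Proof.
move=> v0 kv; split; [split|split].
- by rewrite /semigroup_of /= mod0n v0.
- by move=> a b; exact: semigroup_of_add.
- apply: (@sub_finite_set _ _ `I_((\max_(i < m) v i).+1 * m)); last exact: finite_II.
  move=> s; rewrite /semigroup_of /= => /negP; rewrite -ltnNge => lt_s.
  rewrite -ltn_divLR //; apply: leq_trans lt_s _; rewrite leqW //.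
  exact: (leq_bigmax (Ordinal (ltn_pmod s (ltn0Sn n)))).
- by split=> //; rewrite /semigroup_of /= modnn v0.
- move=> s [s_in s0]; rewrite leqNgt; apply/negP => lt_s.
  have s_gt0 : 0 < s by rewrite lt0n; apply/eqP => s00; apply: s0.
  move: s_in; rewrite /semigroup_of /= modn_small // divn_small //.
  by apply/negP; rewrite -ltnNge; apply: kunzb_gt0; rewrite ?s_gt0.
Qed.

Lemma kunz_vector_semigroup_of (x : n.-tuple nat) :
  kunzb (coord x) -> @kunz_vector_of m (semigroup_of (coord x)) x.
Proof.
move=> kx; split=> [|j]; first exact: semigroup_of_kunz.
have lt_j : j.+1 < m by rewrite ltnS.
exists (tnth x j * m + j.+1); split; last by rewrite addnK mulnK.
split=> [|s [s_in s_mod]].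
  by split; [apply/mem_semigroup_of; rewrite ?coord_tnth | rewrite modnMDl].
move: s_in; rewrite /semigroup_of /= s_mod modn_small // coord_tnth => le_s.
by rewrite (divn_eq s m) s_mod (modn_small lt_j) leq_add2r leq_mul2r le_s orbT.
Qed.

Lemma semigroup_mulm S q : semigroup_of_mult m S -> S (q * m).
Proof.
case=> [[S0 Sadd _] [[Sm _] _]]; elim: q => [//|q IHq].
by rewrite mulSn; apply: Sadd.
Qed.

(** The semigroup is determined by its vector because it is closed under adding
    m; the inequalities say that the sum of two Apery elements is in it. *)
Lemma kunz_vector_ofP S (x : n.-tuple nat) :
  @kunz_vector_of m S x <-> S = semigroup_of (coord x) /\ kunzb (coord x).
Proof.
split=> [|[-> kx]]; last exact: kunz_vector_semigroup_of.
case=> Sm leastS; have [[S0 Sadd _] [_ m_least]] := Sm.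
have memS q (j : 'I_n) : S (q * m + j.+1) <-> coord x j.+1 <= q.
  have lt_j : j.+1 < m by rewrite ltnS.
  have [w [[[Sw w_mod] w_min]]] := leastS j; rewrite -coord_tnth => ->.
  have w_eq : w = (w - j.+1) %/ m * m + j.+1.
    have e : w = w %/ m * m + j.+1 by rewrite {1}(divn_eq w m) w_mod modn_small.
    by rewrite {2}e addnK mulnK.
  split=> [Sq|le_q].
    have := w_min (q * m + j.+1) (conj Sq _); rewrite modnMDl => /(_ erefl).
    by rewrite {1}w_eq leq_add2r leq_pmul2r.
  rewrite -(subnK le_q) mulnDl -addnA; apply: Sadd; first exact: semigroup_mulm.
  by rewrite -w_eq.
have SE : S = semigroup_of (coord x).
  apply/funext => s; apply/propext.
  rewrite (divn_eq s m); case: (s %% m) (ltn_pmod s (ltn0Sn n)) => [|i] lt_i.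
    rewrite mem_semigroup_of // addn0; split=> // _; exact: semigroup_mulm.
  by rewrite mem_semigroup_of // -(memS _ (@Ordinal n i lt_i)).
split=> //; apply/andP; split.
  apply/forallP => i; rewrite lt0n; apply/eqP => xi0.
  have Si : S i.+1 by have /memS := leqnn (coord x i.+1); rewrite xi0.
  have i_neq0 : ~ [set 0]%classic i.+1 by [].
  have := m_least i.+1 (conj Si i_neq0).
  by apply/negP; rewrite -ltnNge ltnS.
apply/forallP => i; apply/forallP => j.
have Si : S (coord x i.+1 * m + i.+1) by apply/memS.
have Sj : S (coord x j.+1 * m + j.+1) by apply/memS.
have := Sadd _ _ Si Sj; rewrite addnACA -mulnDl SE /semigroup_of /=.
by rewrite modnMDl divnMDl.
Qed.

Lemma semigroup_has_kunz S : semigroup_of_mult m S ->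
  exists x : n.-tuple nat, S = semigroup_of (coord x) /\ kunzb (coord x).
Proof.
move=> Sm; have [[S0 Sadd /finite_seqP[gaps gapsE]] _] := Sm.
have class_in (j : 'I_n) : exists w, `[< S w /\ w = j.+1 %[mod m] >].
  pose M := \max_(g <- gaps) g.
  exists (M.+1 * m + j.+1); apply/asboolP.
  split; last by rewrite modnMDl.
  apply/notP => not_in.
  have : (~` S)%classic (M.+1 * m + j.+1) by [].
  rewrite gapsE /= => in_gaps.
  have : M.+1 * m + j.+1 <= M := @leq_bigmax_seq _ _ xpredT id _ in_gaps isT.
  by rewrite /m mulSn mulnS; move: M {in_gaps not_in} => M; lia.
pose w j := ex_minn (class_in j).
exists [tuple (w j - j.+1) %/ m | j < n]; apply/kunz_vector_ofP; split=> // j.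
exists (w j); split; last by rewrite tnth_mktuple.
rewrite /w; case: ex_minnP => k /asboolP k_in k_min; split=> // s s_in.
exact/k_min/asboolP.
Qed.

Definition decr (l : nat) (v : nat -> nat) (i : nat) : nat := v i - (i == l).

(** Lowering coordinate l by 1 adds to the semigroup the single element
    w_l - m, where w_l is its Apery element; the result is a semigroup of
    multiplicity m exactly for the special gaps greater than m. *)
Definition irreducibleb (v : nat -> nat) : bool :=
  kunzb v && [forall l : 'I_n, forall l' : 'I_n,
    (l != l') ==> ~~ (kunzb (decr l.+1 v) && kunzb (decr l'.+1 v))].

(** The largest element of a bigger semigroup that is missing from the smaller
    one can be added alone: its sum with a nonzero element lies in the bigger
    semigroup and is larger, hence lies in the smaller one. *)
Lemma special_gap v v' : v 0 = 0 -> v' 0 = 0 -> kunzb v -> kunzb v' ->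
  (forall i : 'I_n, v' i.+1 <= v i.+1) -> (exists i : 'I_n, v' i.+1 < v i.+1) ->
  exists2 l : 'I_n, v' l.+1 < v l.+1 & kunzb (decr l.+1 v).
Proof.
move=> v0 v'0 kv kv' le_v' [i0 lt_i0].
pose gap (i : 'I_n) := (v i.+1).-1 * m + i.+1.
have [l lt_l max_l] := @arg_maxnP _ i0 (fun i : 'I_n => v' i.+1 < v i.+1) gap lt_i0.
exists l => //; have v'l := kunzb_gt0 kv' (_ : 0 < l.+1 < m).
have le_v i : i < m -> v' i <= v i.
  by case: i => [|i] lt_i; [rewrite v'0 | exact: (le_v' (@Ordinal n i lt_i))].
have {}v'l : 0 < v' l.+1 by apply: v'l; rewrite /= ltnS.
(* The inequality for the sum of index l and any index j. *)
have bound k j : 0 < j < m -> k = (l.+1 + j) %% m ->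
    v k - (k == l.+1) <= v l.+1 - 1 + (v j - (j == l.+1)) + (l.+1 + j) %/ m.
  move=> /andP[j_gt0 lt_j] k_eq.
  have lt_k : k < m by rewrite k_eq ltn_mod.
  have le_j : v' j <= v j - (j == l.+1).
    by case: eqP => [->|_]; [rewrite leq_subRL; lia | rewrite subn0 le_v].
  have := kunzb_add v'0 kv' (_ : l.+1 < m) lt_j; rewrite -k_eq ltnS ltn_ord => /(_ isT) le_k.
  case: (ltngtP (v' k) (v k)) (le_v k lt_k) => // [lt_vk _|eq_vk _]; last first.
    by rewrite -eq_vk; lia.
  case: k k_eq lt_k le_k lt_vk => [|k] k_eq lt_k le_k lt_vk; first by rewrite v0.
  (* An element of residue k is missing too, and the largest one is at most the
     chosen one of residue l. *)
  have := max_l (@Ordinal n k lt_k) lt_vk; rewrite /gap /= => le_gap.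
  have div_eq := divn_eq (l.+1 + j) m; rewrite -k_eq in div_eq.
  have k_l : (k.+1 == l.+1) = false.
    apply/negP => /eqP k_l; rewrite k_l addnC in div_eq.
    move/addIn: div_eq => j_eq; move: lt_j j_gt0; rewrite j_eq.
    by case: (_ %/ _) => [|c]; rewrite ?mul0n // mulSn ltnNge leq_addr.
  move: le_gap div_eq; set c := (_ %/ m) => le_gap div_eq.
  rewrite k_l subn0.
  suff : v k.+1 <= v l.+1 - 1 + c by lia.
  have : (v k.+1).-1 * m < ((v l.+1).-1 + c) * m by rewrite mulnDl; lia.
  by rewrite ltn_mul2r /=; lia.
apply/andP; split.
  apply/forallP => i; rewrite /decr; have := kunzb_gt0 kv (_ : 0 < i.+1 < m).
  rewrite /= ltnS ltn_ord => /(_ isT); case: eqP => [->|_]; lia.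
apply/forallP => i; apply/forallP => j; rewrite /decr.
have lt_i : 0 < i.+1 < m by rewrite /= ltnS.
have lt_j : 0 < j.+1 < m by rewrite /= ltnS.
have [il|il] := eqVneq i.+1 l.+1.
  by have := bound _ _ lt_j erefl; rewrite il.
have [jl|jl] := eqVneq j.+1 l.+1.
  by have := bound _ _ lt_i erefl; rewrite addnC jl (negPf il) subn0 (addnC (_ - _)).
rewrite !subn0; apply: leq_trans (leq_subr _ _) _.
by apply: kunzb_add; rewrite ?ltnS.
Qed.

Lemma semigroup_of_sub v v' : (semigroup_of v `<=` semigroup_of v')%classic <->
  forall i, i < m -> v' i <= v i.
Proof.
split=> [sub i lt_i|le_v s].
  by apply: (mem_semigroup_of _ _ lt_i).1; apply: sub; apply/mem_semigroup_of.
by rewrite /semigroup_of /=; apply: leq_trans; rewrite le_v // ltn_mod.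
Qed.

(** Two distinct special gaps give two minimal oversemigroups that meet in the
    semigroup itself; if there is only one, it belongs to every proper
    oversemigroup, hence to the intersection of any two. *)
Lemma irreducibleP (y : n.-tuple nat) :
  @m_irreducible_vector m y <-> irreducibleb (coord y).
Proof.
split=> [[S [/kunz_vector_ofP[-> ky] [_ irr]]]|/andP[ky irr]].
  apply/andP; split=> //; apply/forallP => l; apply/forallP => l'; apply/implyP => ll'.
  apply/negP => /andP[kl kl']; apply: irr.
  have sub k : (semigroup_of (coord y) `<=` semigroup_of (decr k (coord y)))%classic.
    by apply/semigroup_of_sub => i _; exact: leq_subr.
  have proper (k : 'I_n) : (semigroup_of (coord y) `<` semigroup_of (decr k.+1 (coord y)))%classic.
    split=> [|/semigroup_of_sub /(_ k.+1)]; first exact: sub.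
    rewrite ltnS ltn_ord /decr eqxx => /(_ isT).
    have : 0 < coord y k.+1 by apply: kunzb_gt0 ky _; rewrite /= ltnS.
    by lia.
  exists (semigroup_of (decr l.+1 (coord y))), (semigroup_of (decr l'.+1 (coord y))).
  split; [exact: semigroup_of_kunz | exact: semigroup_of_kunz | exact: proper | exact: proper |].
  apply/seteqP; split=> [s s_in|s []]; first by split; apply: sub.
  rewrite /semigroup_of /decr /=; case: eqP => [->|_]; last by rewrite subn0.
  by rewrite eqSS (negPf (ll' : l != l' :> nat)) subn0.
exists (semigroup_of (coord y)); split; first exact/kunz_vector_ofP.
split=> [|[S1 [S2 [k1 k2 sub1 sub2 S12]]]]; first exact: semigroup_of_kunz.
have gap S' : semigroup_of_mult m S' -> (semigroup_of (coord y) `<` S')%classic ->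
    exists2 l : 'I_n, S' ((coord y l.+1).-1 * m + l.+1) & kunzb (decr l.+1 (coord y)).
  move=> /semigroup_has_kunz[x [-> kx]] [sub not_sub].
  have le_x := (semigroup_of_sub _ _).1 sub.
  have [||l lt_l kl] := @special_gap (coord y) (coord x) erefl erefl ky kx.
  - by move=> i; apply: le_x; rewrite ltnS.
  - apply/existsP; rewrite -[X in is_true X]negbK negb_exists; apply/negP => /forallP le_y.
    apply: not_sub; apply/semigroup_of_sub => -[|i] lt_i //.
    by have := le_y (@Ordinal n i lt_i); rewrite -leqNgt.
  by exists l => //; apply/mem_semigroup_of; rewrite ?ltnS //; lia.
have [l1 in1 kl1] := gap _ k1 sub1; have [l2 in2 kl2] := gap _ k2 sub2.
have [l12|l12] := eqVneq l1 l2.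
  have : semigroup_of (coord y) ((coord y l1.+1).-1 * m + l1.+1).
    by rewrite S12; split; rewrite // l12.
  have : 0 < coord y l1.+1 by apply: kunzb_gt0 ky _; rewrite /= ltnS.
  by rewrite mem_semigroup_of ?ltnS //; lia.
by have /forallP/(_ l1)/forallP/(_ l2) := irr; rewrite l12 kl1 kl2.
Qed.

(** A coordinate x_i is attained because the element (x_i - 1) * m + i is not
    in the semigroup of x, so that some member of the decomposition misses it. *)
Lemma decompositionP (x : n.-tuple nat) D : kunzb (coord x) ->
  @decomposition m x D <->
  [/\ uniq D, {in D, forall y : n.-tuple nat, irreducibleb (coord y)},
      {in D, forall (y : n.-tuple nat) i, tnth y i <= tnth x i} &
      forall i, exists2 y : n.-tuple nat, y \in D & tnth y i = tnth x i].
Proof.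
move=> kx; split=> [[uD irrD [F [FD /kunz_vector_ofP[FE _]]]]|[uD irrD leD covD]].
  have sgD y : y \in D -> F y = semigroup_of (coord y).
    by move=> /FD /kunz_vector_ofP[].
  have leD : {in D, forall (y : n.-tuple nat) i, tnth y i <= tnth x i}.
    move=> y yD i; rewrite -!coord_tnth; apply: (semigroup_of_sub _ _).1; last by rewrite ltnS.
    by rewrite -FE -sgD // => s; apply.
  split=> // [y /irrD /irreducibleP //|i].
  have lt_i : i.+1 < m by rewrite ltnS.
  have xi_gt0 : 0 < tnth x i by rewrite -coord_tnth; apply: kunzb_gt0 kx _.
  apply/notP => no_y.
  suff : semigroup_of (coord x) ((tnth x i).-1 * m + i.+1).
    by rewrite mem_semigroup_of // coord_tnth; lia.
  rewrite -FE => y /= yD; rewrite sgD //; apply/mem_semigroup_of => //.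
  rewrite coord_tnth; have := leD y yD i; rewrite leq_eqVlt => /orP[/eqP xy|].
    by case: no_y; exists y.
  by lia.
split=> // [y /irrD /irreducibleP //|].
exists (fun y => semigroup_of (coord (y : n.-tuple nat))); split.
  by move=> y /irrD /andP[ky _]; apply/kunz_vector_ofP.
apply/kunz_vector_ofP; split=> //; apply/seteqP; split=> s.
  rewrite /semigroup_of /= => in_all.
  case E : (s %% m) (ltn_pmod s (ltn0Sn n)) => [//|i] lt_i.
  have [y yD y_i] := covD (@Ordinal n i lt_i).
  have : coord y (s %% m) <= s %/ m := in_all y yD.
  rewrite E.
  by move: y_i; rewrite -!coord_tnth /= => ->.
move=> s_in y /= yD; apply: (semigroup_of_sub _ _).2 s_in => -[//|i] lt_i.
by rewrite ![coord _ i.+1](coord_tnth _ (Ordinal (lt_i : i < n))) leD.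
Qed.

(** Lower coordinates other than i as long as possible.  If the vector is not
    irreducible, two distinct coordinates can be lowered, and one of them is not
    the coordinate i. *)
Lemma irreducible_below (x : n.-tuple nat) (i : 'I_n) : kunzb (coord x) ->
  exists y : n.-tuple nat, [/\ irreducibleb (coord y),
    forall j, tnth y j <= tnth x j & tnth y i = tnth x i].
Proof.
move=> kx.
suff H N (y : n.-tuple nat) : \sum_j tnth y j <= N -> kunzb (coord y) ->
    (forall j, tnth y j <= tnth x j) -> tnth y i = tnth x i ->
    exists y : n.-tuple nat, [/\ irreducibleb (coord y),
      forall j, tnth y j <= tnth x j & tnth y i = tnth x i].
  exact: (H _ x (leqnn _)).
elim: N y => [|N IHN] y sum_y ky le_y y_i; have [irr|] := boolP (irreducibleb (coord y));
  try by exists y.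
  have := kunzb_gt0 ky (_ : 0 < i.+1 < m); rewrite /= ltnS ltn_ord => /(_ isT).
  by rewrite coord_tnth; move: sum_y; rewrite (bigD1 i) //=; lia.
rewrite /irreducibleb ky /= => /forallPn[l /forallPn[l']].
rewrite negb_imply negbK => /and3P[ll' kl kl'].
have [k ki kk] : exists2 k : 'I_n, k != i & kunzb (decr k.+1 (coord y)).
  have [li|li] := eqVneq l i; last by exists l.
  by exists l' => //; rewrite -li eq_sym.
pose y' := [tuple tnth y j - (j == k) | j < n].
have y'E : coord y' =1 decr k.+1 (coord y).
  case=> [//|j]; rewrite /decr eqSS; have [lt_j|ge_j] := ltnP j n.
    by rewrite ![coord _ j.+1](coord_tnth _ (Ordinal lt_j)) tnth_mktuple.
  have out (z : n.-tuple nat) : coord z j.+1 = 0 by rewrite /coord /= nth_default ?size_tuple.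
  by rewrite !out.
apply: (IHN y').
- have yk : 0 < tnth y k.
    by rewrite -coord_tnth; apply: kunzb_gt0 ky _; rewrite /= ltnS.
  move: sum_y; rewrite (bigD1 k) //= [X in _ -> X <= _](bigD1 k) //= tnth_mktuple eqxx.
  rewrite [X in _ -> _ + X <= _](eq_bigr (tnth y)); first by lia.
  by move=> j jk; rewrite tnth_mktuple (negPf jk) subn0.
- by have -> : coord y' = decr k.+1 (coord y) by apply/funext.
- by move=> j; rewrite tnth_mktuple; apply: leq_trans (leq_subr _ _) _.
- by rewrite tnth_mktuple eq_sym (negPf ki) subn0.
Qed.

End KunzVectors.

(** * The automaton of carries *)

Section CarryAutomaton.

Variables (n : nat) (P : finType).

Definition variable : finType := option ('I_n + P)%type.

Definition atom : finType := (variable * variable * variable * 'I_3 * 'I_3)%type.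

(** The carry of an atom lies between -2 and 2 and is stored with 2 added: it
    starts at b - a, and a column adds at least -1 and at most 2 before the
    halving. *)
Definition carries : finType := {ffun atom -> 'I_5}.

Definition value (x : 'I_n -> nat) (y : P -> nat) (v : variable) : nat :=
  match v with
  | None => 0
  | Some (inl i) => x i
  | Some (inr t) => y t
  end.

Definition initial_carries : carries :=
  [ffun p : atom => let: (_, _, _, a, b) := p in inord (2 + b - a)].

Definition next_carries (q : carries) (x : 'I_n -> bool) (y : P -> bool) : carries :=
  [ffun p : atom =>
     let: (w, u, v, _, _) := p in
     inord ((q p + 2 + value x y u + value x y v - value x y w)./2)].

Definition truth (q : carries) (p : atom) : bool := 1 < q p.

Definition atom_holds (z : variable -> nat) (p : atom) : bool :=
  let: (w, u, v, a, b) := p in z w + a <= z u + z v + b.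

Lemma value_bits x y j v :
  value (fun i => digit j (x i)) (fun t => digit j (y t)) v = digit j (value x y v) :> nat.
Proof. by case: v => [[i|t]|] //=; rewrite /digit upper_bitsE div0n. Qed.

(** The inequality between the numbers that remain after j digits, corrected by
    the carry, has the same truth value for every j: the unread digits
    contribute an even amount to the difference of the sides, so rounding the
    halved carry down preserves the comparison. *)
Lemma carries_invariant x y j (p : atom) :
  let: (w, u, v, a, b) := p in
  (upper_bits j (value x y w) + 2 <= upper_bits j (value x y u) +
     upper_bits j (value x y v) + dfa_run initial_carries next_carries x y j p)
  = atom_holds (value x y) p.
Proof.
case: p => [[[[w u] v] a] b] /=.
elim: j => [|j IHj].
  by rewrite /= ffunE inordK; have := ltn_ord a; have := ltn_ord b; lia.
rewrite -IHj /= ffunE !value_bits => {IHj}.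
set q := dfa_run _ _ _ _ _.
have lt_q := ltn_ord (q (w, u, v, a, b)); move: (nat_of_ord (q _)) lt_q => c lt_c.
have half_digit s : upper_bits j s = digit j s + (upper_bits j.+1 s).*2.
  by rewrite -{1}[upper_bits j s]odd_double_half.
rewrite (half_digit (value x y w)) (half_digit (value x y u)) (half_digit (value x y v)).
have := leq_b1 (digit j (value x y w)); have := leq_b1 (digit j (value x y u)).
have := leq_b1 (digit j (value x y v)).
move: (nat_of_bool _) (nat_of_bool _) (nat_of_bool _) => d1 d2 d3.
by move=> ? ? ?; rewrite inordK; lia.
Qed.

Lemma truthP x y L (p : atom) :
  (forall i, x i < 2 ^ L) -> (forall t, y t < 2 ^ L) ->
  truth (dfa_run initial_carries next_carries x y L) p = atom_holds (value x y) p.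
Proof.
move=> lt_x lt_y.
have small v : upper_bits L (value x y v) = 0.
  apply/eqP; rewrite upper_bits_eq0; case: v => [[i|t]|] //=; exact: expn_gt0.
by have := carries_invariant x y L p; case: p => [[[[w u] v] a] b]; rewrite !small.
Qed.

End CarryAutomaton.

(** * Families of vectors as sets *)

Section Slots.

Variables (K : nat) (T : eqType) (s : 'I_K -> T).

Definition first_slots : seq 'I_K :=
  [seq k : 'I_K <- enum 'I_K | [forall k' : 'I_K, (k' < k) ==> (s k' != s k)]].

Lemma first_slots_inj : {in first_slots &, injective s}.
Proof.
move=> k k'; rewrite !mem_filter => /andP[/forallP k_first _] /andP[/forallP k'_first _] eq_s.
apply: val_inj; case: (ltngtP k k') => // lt_k.
  by have := k'_first k; rewrite lt_k eq_s eqxx.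
by have := k_first k'; rewrite lt_k eq_s eqxx.
Qed.

Lemma uniq_first_slots : uniq [seq s k | k <- first_slots].
Proof. by rewrite (map_inj_in_uniq first_slots_inj); exact/filter_uniq/enum_uniq. Qed.

Lemma mem_first_slots k : s k \in [seq s k' | k' <- first_slots].
Proof.
have [k0 /eqP k0_eq k0_min] := @arg_minnP _ k (fun k' => s k' == s k) val (eqxx _).
apply/mapP; exists k0 => //; rewrite mem_filter mem_enum andbT.
apply/forallP => k'; apply/implyP; rewrite ltnNge; apply: contra => /eqP k'_eq.
by apply: k0_min; rewrite k'_eq k0_eq.
Qed.

Lemma size_first_slots (D : seq T) : (forall k, s k \in D) -> size first_slots <= size D.
Proof.
move=> sD; rewrite -(size_map s); apply: uniq_leq_size uniq_first_slots _.
by move=> _ /mapP[k _ ->].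
Qed.

Lemma size_first_slots_le : size first_slots <= K.
Proof. by rewrite size_filter (leq_trans (count_size _ _)) // size_enum_ord. Qed.

End Slots.

(** * Minimal decompositions as an optimization problem *)

Section Solver.

Variable n : nat.
Hypothesis n_gt0 : 0 < n.
Let m := n.+1.
Let P : finType := ('I_n * 'I_n)%type.

(** The unknowns are n candidate vectors, one in each slot. *)
Definition slot (y : P -> nat) (k : 'I_n) : n.-tuple nat := [tuple y (k, c) | c < n].

(** The conditions are first written in terms of an arbitrary valuation of the
    atoms, since on final states of the automaton only truth values are known. *)
Section Formulas.

Variable o : atom n P -> bool.

Definition le_atom (w : variable n P) (a : nat) (u v : variable n P) (b : nat) : bool :=
  o (w, u, v, inord a, inord b).

Definition yvar (k : 'I_n) (i : nat) : variable n P :=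
  if i is i'.+1 then omap (fun c => inr (k, c)) (insub i' : option 'I_n) else None.

(** The inequalities for the vector in slot [k] with coordinate [l] lowered by 1,
    moved to the sides where no subtraction occurs.  Coordinates start at 1, so
    that [l = 0] lowers nothing. *)
Definition kunz_formula (k : 'I_n) (l : nat) : bool :=
  [forall i : 'I_n, le_atom None (1 + (i.+1 == l)) (yvar k i.+1) None 0] &&
  [forall i : 'I_n, forall j : 'I_n,
     le_atom (yvar k ((i.+1 + j.+1) %% m)) ((i.+1 == l) + (j.+1 == l))
       (yvar k i.+1) (yvar k j.+1)
       ((i.+1 + j.+1) %/ m + ((i.+1 + j.+1) %% m == l))].

Definition irreducible_formula (k : 'I_n) : bool :=
  kunz_formula k 0 && [forall l : 'I_n, forall l' : 'I_n,
    (l != l') ==> ~~ (kunz_formula k l.+1 && kunz_formula k l'.+1)].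

Definition distinct_formula (k k' : 'I_n) : bool :=
  ~~ [forall c : 'I_n, le_atom (yvar k c.+1) 0 (yvar k' c.+1) None 0 &&
                       le_atom (yvar k' c.+1) 0 (yvar k c.+1) None 0].

Definition valid_formula : bool :=
  [forall k : 'I_n, irreducible_formula k] &&
  [forall k : 'I_n, forall c : 'I_n, le_atom (yvar k c.+1) 0 (Some (inl c)) None 0] &&
  [forall c : 'I_n, exists k : 'I_n, le_atom (Some (inl c)) 0 (yvar k c.+1) None 0].

Definition selected : seq 'I_n :=
  [seq k : 'I_n <- enum 'I_n | [forall k' : 'I_n, (k' < k) ==> distinct_formula k' k]].

(** Invalid families cost more than the n slots of any valid one. *)
Definition solution_cost : nat := if valid_formula then size selected else n.+1.

Definition solution_format : seq (symbol + P) :=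
  flatten [seq rcons (flatten [seq [:: inr (k, c); inl Comma] | c <- enum 'I_n])
                     (inl Semicolon) | k <- selected].

Lemma uniq_solution_format : uniq (copied solution_format).
Proof.
have -> : copied solution_format = [seq (k, c) | k <- selected, c <- enum 'I_n].
  rewrite /solution_format /copied; elim: selected => //= k ks IHks.
  rewrite pmap_cat IHks; congr (_ ++ _); rewrite -cats1 pmap_cat /= cats0.
  by elim: (enum _) => //= c cs ->.
apply: allpairs_uniq; [exact/filter_uniq/enum_uniq | exact: enum_uniq |].
by case=> k c [k' c'].
Qed.

End Formulas.

Section Semantics.

Variables (x : n.-tuple nat) (y : P -> nat) (o : atom n P -> bool).
Hypothesis oE : forall p, o p = atom_holds (value (tnth x) y) p.

Lemma le_atomE w a u v b : a <= 2 -> b <= 2 ->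
  le_atom o w a u v b =
  (value (tnth x) y w + a <= value (tnth x) y u + value (tnth x) y v + b).
Proof. by move=> le_a le_b; rewrite /le_atom oE /atom_holds !inordK. Qed.

Lemma value_yvar k i : value (tnth x) y (yvar k i) = coord (slot y k) i.
Proof.
case: i => [//|i]; rewrite /yvar; case: insubP => [c _ <-|ge_i].
  by rewrite coord_tnth tnth_mktuple.
have le_size : size (slot y k) <= i by rewrite size_tuple leqNgt.
exact/esym/(nth_default 0 le_size).
Qed.

(** Positivity of the lowered coordinates makes the truncated subtraction in
    [decr] exact; without it both sides are false. *)
Lemma kunz_formulaE k l : kunz_formula o k l = kunzb n (decr l (coord (slot y k))).
Proof.
rewrite /kunz_formula /kunzb.
have [pos|npos] := boolP [forall i : 'I_n, 0 < decr l (coord (slot y k)) i.+1].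
  have {}pos (i : 'I_n) : (i.+1 == l) < coord (slot y k) i.+1.
    by have /forallP/(_ i) := pos; rewrite /decr; lia.
  congr (_ && _).
    apply/forallP => i; rewrite le_atomE; [|lia|lia]; rewrite value_yvar /decr /=.
    by have := pos i; set z := coord _ _; case: (i.+1 == l); lia.
  apply: eq_forallb => i; apply: eq_forallb => j.
  have le1 : (i.+1 + j.+1) %/ m <= 1.
    by rewrite -ltnS ltn_divLR //; have := ltn_ord i; have := ltn_ord j; rewrite /m; lia.
  rewrite le_atomE; [|lia|lia]; rewrite !value_yvar /decr -/m.
  have := pos i; have := pos j.
  set k' := (_ + _) %% m; set d := (_ + _) %/ m in le1 *.
  have : (k' == l) <= coord (slot y k) k' \/ coord (slot y k) k' = 0.
    by case: (k' == l) (coord _ k') => -[]; [right|left|left|left].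
  move: (coord _ i.+1) (coord _ j.+1) (coord _ k') => vi vj vk.
  by case: (i.+1 == l) (j.+1 == l) (k' == l) => -[] []; lia.
apply/negbTE; apply: contra npos => /andP[/forallP pos _].
by apply/forallP => i; have := pos i; rewrite le_atomE; [|lia|lia]; rewrite value_yvar /decr /=; lia.
Qed.

Lemma irreducible_formulaE k : irreducible_formula o k = irreducibleb n (coord (slot y k)).
Proof.
rewrite /irreducible_formula /irreducibleb kunz_formulaE.
have -> : decr 0 (coord (slot y k)) = coord (slot y k).
  by apply/funext => -[|i]; rewrite /decr ?subn0.
by congr (_ && _); apply: eq_forallb => l; apply: eq_forallb => l'; rewrite !kunz_formulaE.
Qed.

Lemma selectedE : selected o = first_slots (slot y).
Proof.
apply: eq_filter => k; apply: eq_forallb => k'; congr (_ ==> ~~ _).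
apply/forallP/eqP => [same|eq_s c]; last by rewrite !le_atomE // !value_yvar eq_s !addn0 leqnn.
apply: eq_from_tnth => c; have := same c.
by rewrite !le_atomE // !value_yvar !coord_tnth /= !addn0 -eqn_leq => /eqP.
Qed.

Definition good_slots : Prop :=
  [/\ forall k, irreducibleb n (coord (slot y k)),
      forall k c, tnth (slot y k) c <= tnth x c &
      forall c, exists k, tnth (slot y k) c = tnth x c].

Lemma valid_formulaP : reflect good_slots (valid_formula o).
Proof.
have belowE (k c : 'I_n) : le_atom o (yvar k c.+1) 0 (Some (inl c)) None 0 =
                  (tnth (slot y k) c <= tnth x c).
  by rewrite le_atomE // value_yvar coord_tnth /= !addn0.
have coverE (k c : 'I_n) : le_atom o (Some (inl c)) 0 (yvar k c.+1) None 0 =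
                  (tnth x c <= tnth (slot y k) c).
  by rewrite le_atomE // value_yvar coord_tnth /= !addn0.
apply: (iffP idP) => [/andP[/andP[/forallP irr /forallP below] /forallP cover]|].
  have le_x k c : tnth (slot y k) c <= tnth x c by have /forallP/(_ c) := below k; rewrite belowE.
  split=> // [k|c]; first by rewrite -irreducible_formulaE.
  have /existsP[k] := cover c; rewrite coverE => ge_x.
  by exists k; apply/eqP; rewrite eqn_leq le_x.
case=> irr below cover; apply/andP; split; first apply/andP; first split.
- by apply/forallP => k; rewrite irreducible_formulaE.
- by apply/forallP => k; apply/forallP => c; rewrite belowE.
apply/forallP => c; have [k kc] := cover c.
by apply/existsP; exists k; rewrite coverE kc.
Qed.

Lemma solution_formatE :
  flatten [seq item_word y a | a <- solution_format o] =
  encode_vectors [seq slot y k | k <- first_slots (slot y)].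
Proof.
rewrite /solution_format selectedE /encode_vectors -map_comp.
elim: (first_slots _) => //= k ks IHks; rewrite map_cat flatten_cat IHks; congr (_ ++ _).
rewrite map_rcons flatten_rcons /= cats1; congr (rcons _ _).
rewrite /encode_vector /= -map_comp; elim: (enum _) => //= c cs <-.
by rewrite -cats1 -catA.
Qed.

End Semantics.

Lemma good_slots_decomposition (x : n.-tuple nat) (y : P -> nat) :
  kunzb n (coord x) -> good_slots x y ->
  @decomposition m x [seq slot y k | k <- first_slots (slot y)].
Proof.
move=> kx [irr below cover]; apply/decompositionP => //; split.
- exact: uniq_first_slots.
- by move=> _ /mapP[k _ ->].
- by move=> _ /mapP[k _ ->].
- by move=> c; have [k kc] := cover c; exists (slot y k); first exact: mem_first_slots.
Qed.

Definition solver_cost (q : carries n P) : nat := solution_cost (truth q).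

Definition solver_format (q : carries n P) : seq (symbol + P) :=
  solution_format (truth q).

Definition solver : machine :=
  machine_of (optimizer (initial_carries n P) (@next_carries n P)
                solver_cost solver_format).

Definition time_constant : nat := 2 * max_format solver_format + 8.

Lemma slotK (s : 'I_n -> n.-tuple nat) k :
  slot (fun t : P => tnth (s t.1) t.2) k = s k.
Proof. by apply: eq_from_tnth => c; rewrite tnth_mktuple. Qed.

(** A valid family exists by [irreducible_below], so the family found by the
    optimizer is valid and yields a decomposition.  A competing decomposition
    with at most n members fills the slots, repeating a member if necessary,
    and is no smaller by optimality; one with more members is larger than any
    family of n slots. *)
Lemma solver_correct (x : n.-tuple nat) :
  @is_kunz_vector m x ->
  exists D, @minimal_decomposition m x D /\
    computes_within solver (encode_vector x) (encode_vectors D)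
      (time_constant * size (encode_vector x) + time_constant).
Proof.
move=> [S /kunz_vector_ofP[_ kx]].
have inputE : input (tnth x) = encode_vector x.
  by rewrite /input /encode_vector -[in RHS](map_tnth_enum x) -map_comp.
set L := max_size (tnth x).
have lt_x i : tnth x i < 2 ^ L.
  by rewrite -upper_bits_eq0 -leqn0 leqNgt -size_encode_nat -leqNgt; exact: leq_bigmax.
have [y [lt_y opt computes]] := optimizer_computes (initial_carries n P)
  (@next_carries n P) solver_cost (tnth x) (format := solver_format) (fun q => uniq_solution_format (truth q)).
rewrite inputE -/L in opt computes.
have oE z : (forall t, z t < 2 ^ L) -> forall p,
    truth (dfa_run (initial_carries n P) (@next_carries n P) (tnth x) z L) p =
    atom_holds (value (tnth x) z) p.
  by move=> lt_z p; apply: truthP.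
have good_cost s : good_slots x s ->
    solver_cost (dfa_run (initial_carries n P) (@next_carries n P) (tnth x) s L)
    = size (first_slots (slot s)).
  move=> good_s; have lt_s t : s t < 2 ^ L.
    case: t => k i; apply: leq_ltn_trans (lt_x i); case: good_s => _ /(_ k i).
    by rewrite tnth_mktuple.
  rewrite /solver_cost /solution_cost (selectedE (oE s lt_s)); case: (valid_formulaP (oE s lt_s)) => //.
have [s good_s] : exists s, good_slots x s.
  have /choice[f fP] := fun i => irreducible_below i kx.
  exists (fun t => tnth (f t.1) t.2); split=> [k|k i|i]; rewrite ?slotK.
  - by case: (fP k).
  - by case: (fP k).
  - by exists i; rewrite slotK; case: (fP i).
have good_y : good_slots x y.
  apply/(valid_formulaP (oE y lt_y)); have := opt s; rewrite (good_cost s good_s).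
  rewrite {1}/solver_cost {1}/solution_cost; case: ifP => // _ le_n.
  by have := leq_trans le_n (size_first_slots_le _); rewrite ltnn.
exists [seq slot y k | k <- first_slots (slot y)]; split; last first.
  by rewrite -(solution_formatE (oE y lt_y)).
split=> [|D' decD']; first exact: good_slots_decomposition.
rewrite size_map; have [/ltnW lt_n|le_n] := ltnP n (size D').
  exact: leq_trans (size_first_slots_le _) lt_n.
have [uD' irrD' leD' covD'] := (decompositionP _ kx).1 decD'.
have [y0 y0D' _] := covD' (Ordinal n_gt0).
pose s' k := nth y0 D' (k : 'I_n).
have s'D' k : s' k \in D'.
  by rewrite /s'; have [lt_k|ge_k] := ltnP k (size D'); [exact: mem_nth | rewrite nth_default].
pose y' (t : P) := tnth (s' t.1) t.2.
have good_y' : good_slots x y'.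
  split=> [k|k i|i]; rewrite ?slotK.
  - exact: irrD'.
  - exact: leD'.
  - have [z zD' z_i] := covD' i.
    have lt_z : index z D' < n by apply: leq_trans le_n; rewrite index_mem.
    by exists (Ordinal lt_z); rewrite slotK /s' nth_index.
have := opt y'; rewrite (good_cost y good_y) (good_cost y' good_y') => /leq_trans; apply.
by apply: size_first_slots => k; rewrite slotK.
Qed.

End Solver.

Theorem mainTheorem5 (m : nat) (hm : 2 <= m) :
  poly_time_solvable (@encode_vector m.-1) (@encode_vectors m.-1)
    (@is_kunz_vector m) (@minimal_decomposition m).
Proof.
case: m hm => [//|n n_gt0]; exists (solver n), (time_constant n), 1 => x kx.
have [D [minD computes]] := solver_correct n_gt0 kx.
by exists D; split=> //; rewrite expn1.
Qed.
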